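(* There is a quantum function $BinSearch$ definable within $EQS_0+IV$ satisfying, for every $k\ge1$, every $m\in\{1,\dots,2^k\}$ with $x=bin_k(m)$, every $s\in\{0,1\}^{2^k}$ and every $b\in\{0,1\}$, $$BinSearch(|\tilde x\rangle|\hat b\rangle|\hat 2\rangle|s\rangle)=|\tilde x\rangle|\widehat{b\oplus s_{(m)}}\rangle|\hat 2\rangle|s\rangle,$$ where $s_{(m)}$ is the $m$-th bit of $s$.
   Context: Encodings: $\hat0=000$, $\hat1=001$, $\hat2=111$, $\hat\dashv=011$; for $x=x_1\cdots x_k\in\{0,1\}^k$, $\tilde x=\hat x_1\hat x_2\cdots\hat x_k\hat\dashv$. $bin_k(m)$ is the $m$-th string of $\{0,1\}^k$ in lexicographic order ($bin_k(1)=0^k$). Notation. For $n\ge1$, $\mathcal H_{2^n}$ is the Hilbert space with orthonormal computational basis $\{|s\rangle: s\in\{0,1\}^n\}$ and $\mathcal H_\infty=\bigcup_{n\ge1}\mathcal H_{2^n}$. For nonzero $|\phi\rangle\in\mathcal H_{2^n}$, $\ell(|\phi\rangle)=n$; $\mathbf 0$ and scalars have length $0$. A quantum function is a map $\mathcal H_\infty\to\mathcal H_\infty$. For a binary string $u$ and $|\phi\rangle=\sum_{w\in\{0,1\}^n}\alpha_w|w\rangle$: if $|u|<n$, $\langle u|\phi\rangle=\sum_{z\in\{0,1\}^{n-|u|}}\alpha_{uz}|z\rangle$; if $|u|=n$ it is the scalar $\alpha_u$; if $|u|>n$ it is $\mathbf 0$. Conventions: $|\phi\rangle\otimes\mathbf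 0=\mathbf 0\otimes|\phi\rangle=\mathbf 0$, $0\otimes|\phi\rangle=\mathbf 0$, $\alpha\otimes|\phi\rangle=\alpha|\phi\rangle$ for scalars. $|s\rangle|u\rangle=|su\rangle$. $LH(n)=\lceil n/2\rceil$, $RH(n)=\lfloor n/2\rfloor$, applied to $|\phi\rangle$ via $\ell(|\phi\rangle)$; $\mathrm{ilog}(n)=\lceil\log_2n\rceil$, $\mathrm{ilog}(0)=0$. $K$ is a fixed amplitude set. For $r_0\in\{0,1\}^+$, $NON_{r_0}$ is the set of nonempty strings $x$ with $|r_0|$ dividing $|x|$ such that no consecutive length-$|r_0|$ block of $x$ equals $r_0$; $NON_{r_0}(|\phi\rangle)=\{x\in NON_{r_0}:\langle xr_0|\phi\rangle\neq\mathbf 0\}$. Scheme I, $\theta\in[0,2\pi)\cap K$, $a\in\{0,1\}$: $I$; $PHASE_\theta(|\phi\rangle)=|0\rangle\langle0|\phi\rangle+e^{i\theta}|1\rangle\langle1|\phi\rangle$; $ROT_\theta(|\phi\rangle)=\cos\theta|\phi\rangle+\sin\theta(|1\rangle\langle0|\phi\rangle-|0\rangle\langle1|\phi\rangle)$; $NOT(|\phi\rangle)=|0\rangle\langle1|\phi\rangle+|1\rangle\langle0|\phi\rangle$; $SWAP(|\phi\rangle)=|\phi\rangle$ if $\ell(|\phi\rangle)\le1$, else $\sum_{a,b}|ab\rangle\langle ba|\phi\rangle$; $MEAS[a](|\phi\rangle)=|a\rangle\langle a|\phi\rangle$. Scheme II: $Compo[g,h]=g\circ h$. Scheme III: $Branch[g,h](|\phi\rangle)=|\phi\rangle$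 if $\ell(|\phi\rangle)\le1$, else $|0\rangle\otimes g(\langle0|\phi\rangle)+|1\rangle\otimes h(\langle1|\phi\rangle)$. Auxiliary: $HalfSWAP(|\phi\rangle)=|\phi\rangle$ if $\ell(|\phi\rangle)\le1$, else $\sum_{|s|=LH(|\phi\rangle)}\langle s|\phi\rangle\otimes|s\rangle$; $CodeSKIP_+[r_0,g,h](|\phi\rangle)=|\phi\rangle$ if $NON_{r_0}(|\phi\rangle)=\emptyset$, else $\sum_{x\in NON_{r_0}(|\phi\rangle)}g(|xr_0\rangle)\otimes h(\langle xr_0|\phi\rangle)$; $CodeSKIP_-$ is the same with $g(|x\rangle)\otimes h(\langle x|\phi\rangle)$. Scheme IV: given $d,g,h$ ($d$ not using $MEAS$; $d,h$ may use $CodeSKIP_\pm$), $t\in\mathbb N^+$, $r_0$, $p_u\in\{I,HalfSWAP\}$ and $f_u\in\{I,F\}$ for $|u|=|r_0|$, $F=CFQRec_t[r_0,d,g,h\mid\{p_u\},\{f_u\}]$ is: with $k=\mathrm{ilog}(\ell(|\phi\rangle))$, $F(|xr_0\rangle|\phi\rangle)=g(|xr_0\rangle|\phi\rangle)$ if $x=\lambda$, $\ell(|\phi\rangle)\le t$ or $|x|>|r_0|k$; otherwise ($x\in NON_{r_0}$) $F(|xr_0\rangle|\phi\rangle)=\sum_{|u|=|r_0|}\sum_{|v|=\ell(\langle u|xr_0\rangle)}h(|u\rangle|v\rangle)\otimes p_u^{-1}(\langle v|\zeta_u\rangle)$ where $d(|xr_0\rangle)=|x'r_0\rangle$, $x'\in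 NON_{r_0}$, $|\psi_u\rangle=p_u(|\phi\rangle)$, $m_u=LH$ if $p_u=I$, $RH$ if $p_u=HalfSWAP$, $|\zeta_u\rangle=\sum_{|s|=m_u(|\phi\rangle)}f_u(\langle u|x'r_0\rangle\otimes|s\rangle)\otimes\langle s|\psi_u\rangle$; $F(|y\rangle)=|y\rangle$ if $NON_{r_0}(|y\rangle)=\emptyset$; extended linearly. $EQS_0+IV$ = functions obtained from Scheme I by finitely many applications of Schemes II–IV. ''Definable within'' a class means some member of the class satisfies the stated equations. *)

(* Defs.v *)
From HB Require Import structures.
From mathcomp Require Import all_boot all_order all_algebra.
From mathcomp Require Import all_classical all_reals all_analysis.
From mathcomp Require Import complex.
From mathcomp Require Import zify.

Set Implicit Arguments.
Unset Strict Implicit.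
Unset Printing Implicit Defensive.

Import Order.TTheory GRing.Theory Num.Theory.
Local Open Scope classical_set_scope.
Local Open Scope ring_scope.
Local Open Scope complex_scope.

(* A vector is the family of its amplitudes, indexed by all binary strings; a
   vector of the 2^n-dimensional space is one supported on strings of length n
   ([Hsp n] below). The null vectors of all these spaces are thus identified,
   and a scalar a is the family supported on the empty string with value a
   ([Hsp 0]); with this encoding the conventions on <u|phi> when |u| >= n and
   on tensor products with scalars and with the null vector hold by
   computation. *)
Definition qvec (R : realType) : Type := seq bool -> R[i].

Definition qfun (R : realType) : Type := qvec R -> qvec R.

Definition Hsp {R : realType} (n : nat) : set (qvec R) :=
  [set phi | forall w, phi w != 0 -> size w = n].

Definition ket {R : realType} (s : seq bool) : qvec R := fun w => (w == s)%:R.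

Definition bra {R : realType} (u : seq bool) (phi : qvec R) : qvec R :=
  fun z => phi (u ++ z).

Definition qscale {R : realType} (a : R[i]) (phi : qvec R) : qvec R :=
  fun w => a * phi w.

Definition tens {R : realType} (phi psi : qvec R) : qvec R :=
  fun w => \sum_(i < (size w).+1) phi (take i w) * psi (drop i w).

Notation "a *q phi" := (qscale a phi) (at level 40, left associativity).
Notation "phi ⊗ psi" := (tens phi psi) (at level 40, left associativity).

(* [qlen 0 = 0], and [qlen phi = n] for every nonzero [phi] of [Hsp n]. *)
Definition qlen {R : realType} (phi : qvec R) : nat :=
  xget 0%N [set n | exists2 w, size w = n & phi w != 0].

Definition LH (n : nat) : nat := uphalf n.
Definition RH (n : nat) : nat := n./2.

(* [up_log 2 n] is the ceiling of log_2 n for n > 0, and [up_log 2 0 = 0]. *)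
Definition ilog (n : nat) : nat := up_log 2 n.

(* "Consecutive blocks" are the aligned ones: x is cut into |x|/|r0| pieces. *)
Definition NON (r0 : seq bool) : set (seq bool) :=
  [set x | [/\ x <> [::], (size r0 %| size x)%N &
     forall j, (j < size x %/ size r0)%N ->
       take (size r0) (drop (j * size r0) x) <> r0]].

Definition NONv {R : realType} (r0 : seq bool) (phi : qvec R) :
    set (seq bool) :=
  [set x | NON r0 x /\ bra (x ++ r0) phi <> 0].

Definition PHASE {R : realType} (theta : R) : qfun R := fun phi =>
  ket [:: false] ⊗ bra [:: false] phi +
  (cos theta +i* sin theta) *q (ket [:: true] ⊗ bra [:: true] phi).

Definition ROT {R : realType} (theta : R) : qfun R := fun phi =>
  (cos theta)%:C *q phi +
  (sin theta)%:C *q (ket [:: true] ⊗ bra [:: false] phi -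
                     ket [:: false] ⊗ bra [:: true] phi).

Definition NOT {R : realType} : qfun R := fun phi =>
  ket [:: false] ⊗ bra [:: true] phi + ket [:: true] ⊗ bra [:: false] phi.

Definition SWAP {R : realType} : qfun R := fun phi =>
  if (qlen phi <= 1)%N then phi
  else \sum_(a : bool) \sum_(b : bool) ket [:: a; b] ⊗ bra [:: b; a] phi.

Definition MEAS {R : realType} (a : bool) : qfun R := fun phi =>
  ket [:: a] ⊗ bra [:: a] phi.

Definition Branch {R : realType} (g h : qfun R) : qfun R := fun phi =>
  if (qlen phi <= 1)%N then phi
  else ket [:: false] ⊗ g (bra [:: false] phi) +
       ket [:: true] ⊗ h (bra [:: true] phi).

Definition rotate {R : realType} (m : nat) (phi : qvec R) : qvec R :=
  \sum_(s : m.-tuple bool) bra s phi ⊗ ket s.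

Definition HalfSWAP {R : realType} : qfun R := fun phi =>
  if (qlen phi <= 1)%N then phi else rotate (LH (qlen phi)) phi.

(* The inverse of [HalfSWAP]: see [HalfSWAPK] and [HalfSWAPVK]. *)
Definition HalfSWAPV {R : realType} : qfun R := fun phi =>
  if (qlen phi <= 1)%N then phi else rotate (RH (qlen phi)) phi.

Definition CodeSKIPp {R : realType} (r0 : seq bool) (g h : qfun R) : qfun R :=
  fun phi =>
    if `[< NONv r0 phi = set0 >] then phi
    else \sum_(x \in NONv r0 phi) (g (ket (x ++ r0)) ⊗ h (bra (x ++ r0) phi)).

Definition CodeSKIPm {R : realType} (r0 : seq bool) (g h : qfun R) : qfun R :=
  fun phi =>
    if `[< NONv r0 phi = set0 >] then phi
    else \sum_(x \in NONv r0 phi) (g (ket x) ⊗ h (bra x phi)).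

(* The families p_u, f_u are given by booleans: [p u] holds when
   p_u = HalfSWAP (and not I), [f u] holds when f_u = F (and not I). *)
Definition pfun {R : realType} (b : bool) : qfun R :=
  if b then HalfSWAP else id.
Definition pfunV {R : realType} (b : bool) : qfun R :=
  if b then HalfSWAPV else id.
Definition mfun (b : bool) : nat -> nat := if b then RH else LH.

(* |zeta_u>, where [y] stands for x'r_0. *)
Definition zeta {R : realType} (F : qfun R) (pu fu : bool) (u y : seq bool)
    (phi : qvec R) : qvec R :=
  \sum_(s : (mfun pu (qlen phi)).-tuple bool)
    (if fu then F else id) (bra u (ket y) ⊗ ket s) ⊗ bra s (pfun pu phi).

Definition cfq_base (t : nat) (r0 x : seq bool) (l : nat) : Prop :=
  [\/ x = [::], (l <= t)%N | (size r0 * ilog l < size x)%N].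

(* [is_CFQRec t r0 d g h p f F] : F is
   CFQRec_t[r0,d,g,h|{p_u},{f_u}], i.e. satisfies its defining equations and is
   linear on each space. Inputs beginning with r0 are the case x = lambda of
   the first equation, so the last one does not concern them. *)
Record is_CFQRec {R : realType} (t : nat) (r0 : seq bool) (d g h : qfun R)
    (p f : (size r0).-tuple bool -> bool) (F : qfun R) : Prop := IsCFQRec {
  cfq_linear : forall n a (phi psi : qvec R), Hsp n phi -> Hsp n psi ->
    F (a *q phi + psi) = a *q F phi + F psi;
  cfq_baseE : forall x n (phi : qvec R), x = [::] \/ NON r0 x -> Hsp n phi ->
    cfq_base t r0 x (qlen phi) ->
    F (ket (x ++ r0) ⊗ phi) = g (ket (x ++ r0) ⊗ phi);
  cfq_stepE : forall x x' n (phi : qvec R), NON r0 x -> NON r0 x' ->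
    d (ket (x ++ r0)) = ket (x' ++ r0) -> Hsp n phi ->
    ~ cfq_base t r0 x (qlen phi) ->
    F (ket (x ++ r0) ⊗ phi) =
    \sum_(u : (size r0).-tuple bool)
     \sum_(v : (qlen (bra u (ket (x ++ r0) : qvec R))).-tuple bool)
       h (ket u ⊗ ket v) ⊗
         pfunV (p u) (bra v (zeta F (p u) (f u) u (x' ++ r0) phi));
  cfq_restE : forall y, ~~ prefix r0 y -> NONv r0 (ket y : qvec R) = set0 ->
    F (ket y) = ket y
}.
Arguments is_CFQRec {R} t r0 d g h p f F.

(* [EQS K cs ms] : the quantum functions built from the initial functions by
   Compo, Branch and CFQRec, where [cs] tells whether CodeSKIP may also be used,
   and [ms] whether MEAS may be used. CFQRec applies only to those [d] that map
   every code |x r0> to a code |x' r0>. *)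
Inductive EQS {R : realType} (K : set R[i]) : bool -> bool -> qfun R -> Prop :=
| EQS_I cs ms : EQS K cs ms id
| EQS_PHASE cs ms theta : 0 <= theta < 2 * pi -> K theta%:C ->
    EQS K cs ms (PHASE theta)
| EQS_ROT cs ms theta : 0 <= theta < 2 * pi -> K theta%:C ->
    EQS K cs ms (ROT theta)
| EQS_NOT cs ms : EQS K cs ms NOT
| EQS_SWAP cs ms : EQS K cs ms SWAP
| EQS_MEAS cs a : EQS K cs true (MEAS a)
| EQS_Compo cs ms g h : EQS K cs ms g -> EQS K cs ms h ->
    EQS K cs ms (g \o h)
| EQS_Branch cs ms g h : EQS K cs ms g -> EQS K cs ms h ->
    EQS K cs ms (Branch g h)
| EQS_CodeSKIPp ms r0 g h : r0 <> [::] -> EQS K true ms g -> EQS K true ms h ->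
    EQS K true ms (CodeSKIPp r0 g h)
| EQS_CodeSKIPm ms r0 g h : r0 <> [::] -> EQS K true ms g -> EQS K true ms h ->
    EQS K true ms (CodeSKIPm r0 g h)
| EQS_CFQRec cs ms t r0 d g h p f F : (0 < t)%N -> r0 <> [::] ->
    EQS K true false d -> EQS K false ms g -> EQS K true ms h ->
    (forall x, NON r0 x ->
       exists2 x', NON r0 x' & d (ket (x ++ r0)) = ket (x' ++ r0)) ->
    is_CFQRec t r0 d g h p f F ->
    EQS K cs ms F.

Definition EQS0_IV {R : realType} (K : set R[i]) : qfun R -> Prop :=
  EQS K false true.

Definition hat (a : bool) : seq bool := [:: false; false; a].
Definition hat2 : seq bool := [:: true; true; true].
Definition hatend : seq bool := [:: false; true; true].
Definition tilde (x : seq bool) : seq bool := flatten (map hat x) ++ hatend.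

(* The strings of length k in lexicographic order; [bin k m] is the m-th one,
   counting from 1. *)
Fixpoint lex_strings (k : nat) : seq (seq bool) :=
  if k is k'.+1 then
    map (cons false) (lex_strings k') ++ map (cons true) (lex_strings k')
  else [:: [::]].
Definition bin (k m : nat) : seq bool := nth [::] (lex_strings k) m.-1.

Lemma bra_ket {R : realType} (u z : seq bool) :
  bra u (ket (u ++ z) : qvec R) = ket z.
Proof. by apply/funext => w; rewrite /bra /ket eqseq_cat// eqxx. Qed.

Lemma tens_ketr {R : realType} (phi : qvec R) s w :
  (phi ⊗ ket s) w =
  if drop (size w - size s) w == s then phi (take (size w - size s) w) else 0.
Proof.
rewrite /tens /ket.
have sz : (size w - size s < (size w).+1)%N by rewrite ltnS leq_subr.
rewrite (bigD1 (Ordinal sz)) //= big1 ?addr0.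
  by case: eqP => _; rewrite ?mulr1 ?mulr0.
move=> i ni; case: eqP => [e|_]; last by rewrite mulr0.
case/eqP: ni; apply/val_inj => /=.
by rewrite -e size_drop subKn// -ltnS.
Qed.

Lemma tens_ket {R : realType} (s u : seq bool) :
  ket s ⊗ ket u = ket (s ++ u) :> qvec R.
Proof.
apply/funext => w; rewrite tens_ketr /ket.
have [->|n] := eqVneq w (s ++ u).
  by rewrite size_cat addnK drop_size_cat// take_size_cat// !eqxx.
case: eqP => // e; case: eqP => // e'; case/eqP: n.
by rewrite -(cat_take_drop (size w - size u) w) e e'.
Qed.

Lemma qlenE {R : realType} (phi : qvec R) n :
  Hsp n phi -> phi <> 0 -> qlen phi = n.
Proof.
move=> H nz; rewrite /qlen; case: xgetP => [m _ [w <- /H]//|h].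
exfalso; apply: nz; apply/funext => w; have [->//|nw] := eqVneq (phi w) 0.
by case: (h (size w)); exists w.
Qed.

Lemma qlen0 {R : realType} : qlen (0 : qvec R) = 0%N.
Proof. by rewrite /qlen; case: xgetP => // m _ [w _]; rewrite eqxx. Qed.

Lemma rotateE {R : realType} (phi : qvec R) n m w :
  Hsp n phi -> (m <= n)%N ->
  rotate m phi w =
  if size w == n then phi (drop (n - m) w ++ take (n - m) w) else 0.
Proof.
move=> H mn; rewrite /rotate fct_sumE.
have [sw|sw] := eqVneq (size w) n; last first.
  rewrite big1// => s _; rewrite tens_ketr; case: eqP => // e.
  rewrite /bra; apply/eqP; apply: contraNT sw => /H.
  have := congr1 size e; rewrite size_drop size_cat size_take_min !size_tuple.
  move=> e1; rewrite (minn_idPl (leq_subr _ _)) => <-.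
  by rewrite subnKC ?eqxx// -[X in (X <= _)%N]e1 leq_subr.
have sd : size (drop (n - m) w) == m by rewrite size_drop sw subKn.
rewrite (bigD1 (Tuple sd)) //= big1 ?addr0.
  by rewrite tens_ketr /= size_drop !sw subKn ?leq_subr// eqxx.
move=> s ns; rewrite tens_ketr size_tuple sw; case: eqP => // e.
by case/eqP: ns; apply/val_inj; rewrite /= e.
Qed.

Lemma Hsp_rotate {R : realType} (phi : qvec R) n m :
  Hsp n phi -> (m <= n)%N -> Hsp n (rotate m phi).
Proof.
move=> H mn w; rewrite (rotateE _ H mn); case: (size w =P n) => // _.
by rewrite eqxx.
Qed.

Lemma rotateK {R : realType} (phi : qvec R) n m :
  Hsp n phi -> (m <= n)%N -> rotate (n - m) (rotate m phi) = phi.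
Proof.
move=> H mn; apply/funext => w.
rewrite (rotateE _ (Hsp_rotate H mn) (leq_subr _ _)) (rotateE _ H mn) subKn//.
have [sw|/eqP sw] := eqVneq (size w) n; last first.
  by have [->//|/H] := eqVneq (phi w) 0.
rewrite size_cat size_drop size_take_min sw (minn_idPl mn) subnK// eqxx.
rewrite drop_size_cat ?size_drop ?sw// take_size_cat ?size_drop ?sw//.
by rewrite cat_take_drop.
Qed.

Lemma rotate_eq0 {R : realType} (phi : qvec R) n m :
  Hsp n phi -> (m <= n)%N -> phi <> 0 -> rotate m phi <> 0.
Proof.
move=> H mn nz e; apply: nz; rewrite -(rotateK H mn) e.
rewrite /rotate big1// => s _; apply/funext => w.
by rewrite tens_ketr /bra; case: ifP.
Qed.

Lemma HalfSWAPK {R : realType} (phi : qvec R) n :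
  Hsp n phi -> HalfSWAPV (HalfSWAP phi) = phi.
Proof.
move=> H; rewrite /HalfSWAP /HalfSWAPV; case: (leqP (qlen phi) 1) => [->//|l1].
have nz : phi <> 0 by move=> p0; rewrite p0 qlen0 in l1.
have ln : (LH n <= n)%N by rewrite /LH uphalf_half; have := odd_double_half n; lia.
rewrite (qlenE H nz) in l1 *.
rewrite (qlenE (Hsp_rotate H ln) (rotate_eq0 H ln nz)) leqNgt l1 /=.
suff -> : RH n = (n - LH n)%N by exact: rotateK.
by rewrite /LH /RH uphalf_half; have := odd_double_half n; lia.
Qed.

Lemma HalfSWAPVK {R : realType} (phi : qvec R) n :
  Hsp n phi -> HalfSWAP (HalfSWAPV phi) = phi.
Proof.
move=> H; rewrite /HalfSWAP /HalfSWAPV; case: (leqP (qlen phi) 1) => [->//|l1].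
have nz : phi <> 0 by move=> p0; rewrite p0 qlen0 in l1.
have ln : (RH n <= n)%N by rewrite /RH; have := odd_double_half n; lia.
rewrite (qlenE H nz) in l1 *.
rewrite (qlenE (Hsp_rotate H ln) (rotate_eq0 H ln nz)) leqNgt l1 /=.
suff -> : LH n = (n - RH n)%N by exact: rotateK.
by rewrite /LH /RH uphalf_half; have := odd_double_half n; lia.
Qed.

Lemma Hsp0 {R : realType} n : Hsp n (0 : qvec R).
Proof. by move=> w; rewrite eqxx. Qed.

Lemma HspD {R : realType} n (phi psi : qvec R) :
  Hsp n phi -> Hsp n psi -> Hsp n (phi + psi).
Proof.
move=> H1 H2 w /eqP nz; have [e|/H1//] := eqVneq (phi w) 0.
by apply: H2; apply/eqP => e2; apply: nz; change (phi w + psi w = 0); rewrite e e2 addr0.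
Qed.

Lemma HspZ {R : realType} n a (phi : qvec R) : Hsp n phi -> Hsp n (a *q phi).
Proof.
by move=> H w nz; apply: H; apply: contraNneq nz => e; rewrite /qscale e mulr0.
Qed.

Lemma HspN {R : realType} n (phi : qvec R) : Hsp n phi -> Hsp n (- phi).
Proof.
move=> H w nz; apply: H; apply: contraNneq nz => e.
by change (- phi w == 0); rewrite e oppr0.
Qed.

Lemma Hsp_sum {R : realType} I (r : seq I) (P : pred I) (E : I -> qvec R) n :
  (forall i, Hsp n (E i)) -> Hsp n (\sum_(i <- r | P i) E i).
Proof. by move=> H; apply: big_ind => //; [exact: Hsp0 | exact: HspD]. Qed.

Lemma Hsp_ket {R : realType} s : Hsp (size s) (ket s : qvec R).
Proof. by move=> w; rewrite /ket; have [->//|_] := eqVneq w s; rewrite eqxx. Qed.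

Lemma ket_neq0 {R : realType} s : (ket s : qvec R) <> 0.
Proof.
by move=> /(congr1 (fun f : qvec R => f s))/eqP; rewrite /ket eqxx oner_eq0.
Qed.

Lemma qlen_ket {R : realType} s : qlen (ket s : qvec R) = size s.
Proof. exact: qlenE (@Hsp_ket _ s) (@ket_neq0 _ s). Qed.

Lemma Hsp_tens {R : realType} m n (phi psi : qvec R) :
  Hsp m phi -> Hsp n psi -> Hsp (m + n) (phi ⊗ psi).
Proof.
move=> H1 H2 w nz; have [//|/eqP ne] := eqVneq (size w) (m + n)%N.
case/eqP: nz; rewrite /tens big1// => i _.
have [->|/H1 s1] := eqVneq (phi (take i w)) 0; first by rewrite mul0r.
have [->|/H2 s2] := eqVneq (psi (drop i w)) 0; first by rewrite mulr0.
by case: ne; rewrite -s1 -s2 -size_cat cat_take_drop.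
Qed.

Lemma Hsp_bra {R : realType} n u (phi : qvec R) :
  Hsp n phi -> Hsp (n - size u) (bra u phi).
Proof. by move=> H w /H <-; rewrite size_cat addKn. Qed.

Lemma bra_long {R : realType} n u (phi : qvec R) :
  Hsp n phi -> (n < size u)%N -> bra u phi = 0.
Proof.
move=> H lt; apply/funext => w; have [//|/H e] := eqVneq (bra u phi w) 0.
by move: lt; rewrite -e size_cat ltnNge leq_addr.
Qed.

Definition Hpres {R : realType} (f : qfun R) : Prop :=
  forall n phi, Hsp n phi -> Hsp n (f phi).

Lemma Hpres0 {R : realType} (f : qfun R) : Hpres f -> f 0 = 0.
Proof.
move=> H; apply/funext => w; have [//|nz] := eqVneq (f 0 w) 0.
have := H (size w).+1 0 (@Hsp0 _ _) w nz => e; lia.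
Qed.

Lemma tens0 {R : realType} (phi : qvec R) : phi ⊗ 0 = 0.
Proof.
by apply/funext => w; rewrite /tens big1// => i _; rewrite mulr0.
Qed.

Lemma Hsp_tens_bra {R : realType} n u (chi phi : qvec R) (h : qfun R) :
  Hpres h -> Hsp (size u) chi -> Hsp n phi -> Hsp n (chi ⊗ h (bra u phi)).
Proof.
move=> Hh Hc Hp; have [le|lt] := leqP (size u) n.
  by rewrite -(subnKC le); apply: Hsp_tens => //; apply: Hh; exact: Hsp_bra.
by rewrite (bra_long Hp lt) Hpres0// tens0; exact: Hsp0.
Qed.

Lemma Hpres_id {R : realType} : Hpres (id : qfun R).
Proof. by []. Qed.

Lemma Hpres_pfun {R : realType} b : Hpres (pfun b : qfun R).
Proof.
case: b => // n phi H; rewrite /pfun /HalfSWAP; case: ifP => // l1.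
have nz : phi <> 0 by move=> p0; rewrite p0 qlen0 in l1.
apply: Hsp_rotate => //; rewrite (qlenE H nz) /LH uphalf_half.
by have := odd_double_half n; lia.
Qed.

Lemma Hpres_pfunV {R : realType} b : Hpres (pfunV b : qfun R).
Proof.
case: b => // n phi H; rewrite /pfunV /HalfSWAPV; case: ifP => // l1.
have nz : phi <> 0 by move=> p0; rewrite p0 qlen0 in l1.
apply: Hsp_rotate => //; rewrite (qlenE H nz) /RH.
by have := odd_double_half n; lia.
Qed.

Lemma ket_sum {R : realType} n (phi : qvec R) : Hsp n phi ->
  phi = \sum_(s : n.-tuple bool) phi s *q ket s.
Proof.
move=> H; apply/funext => w; rewrite fct_sumE.
have [sw|sw] := eqVneq (size w) n; last first.
  rewrite big1; first by apply/eqP; apply: contraNT sw => /H/eqP.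
  move=> s _; rewrite /qscale /ket; case: eqP => [e|_]; last by rewrite mulr0.
  by rewrite e size_tuple eqxx in sw.
rewrite (bigD1 (Tuple (introT eqP sw))) //= big1 ?addr0.
  by rewrite /qscale /ket eqxx mulr1.
move=> s ns; rewrite /qscale /ket; case: eqP => [e|_]; last by rewrite mulr0.
by case/eqP: ns; exact/val_inj.
Qed.

Lemma CFQRec_Hpres {R : realType} t r0 (d g h : qfun R) p f F :
  (0 < t)%N -> Hpres d -> Hpres g -> Hpres h ->
  (forall x, NON r0 x ->
     exists2 x', NON r0 x' & d (ket (x ++ r0)) = ket (x' ++ r0)) ->
  is_CFQRec t r0 d g h p f F -> Hpres F.
Proof.
move=> t0 Hd Hg Hh dP [lin base step rest].
have F0 : F 0 = 0.
  have := lin 0%N (-1) 0 0 (@Hsp0 _ _) (@Hsp0 _ _).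
  have E (phi : qvec R) : -1 *q phi + phi = 0.
    apply/funext => w; change (-1 * phi w + phi w = 0).
    by rewrite mulN1r addNr.
  by rewrite !E.
suff main N y : size y = N -> Hsp N (F (ket y)).
  move=> n phi H; rewrite (ket_sum H).
  suff [_] : Hsp n (\sum_(s : n.-tuple bool) phi s *q ket s) /\
    Hsp n (F (\sum_(s : n.-tuple bool) phi s *q ket s)) by [].
  elim/big_rec: _ => [|s psi _ [H1 H2]]; first by rewrite F0; split; exact: Hsp0.
  have Hk : Hsp n (ket s : qvec R) by have := @Hsp_ket R s; rewrite size_tuple.
  split; first by apply: HspD => //; exact: HspZ.
  by rewrite (lin n)//; apply: HspD => //; apply/HspZ/main; rewrite size_tuple.
elim/ltn_ind: N y => N IH y sy.
have [pr|npr] := boolP (prefix r0 y).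
  case/prefixP: pr => z yE.
  have -> : ket y = ket ([::] ++ r0) ⊗ ket z :> qvec R by rewrite tens_ket yE.
  rewrite (base [::] (size z)); first last.
  - by constructor.
  - exact: Hsp_ket.
  - by left.
  by apply: Hg; rewrite tens_ket -yE -sy; exact: Hsp_ket.
have [e0|] := pselect (NONv r0 (ket y : qvec R) = set0).
  by rewrite rest// -sy; exact: Hsp_ket.
case/eqP/set0P => x [nx bx].
have /prefixP[z yE] : prefix (x ++ r0) y.
  rewrite prefixE; apply/negP => np; apply: bx.
  apply/funext => w; rewrite /bra /ket; case: eqP => // e.
  by case: np; rewrite -e take_size_cat.
have -> : ket y = ket (x ++ r0) ⊗ ket z :> qvec R by rewrite tens_ket yE.
have Hz := @Hsp_ket R z.
have [b|nb] := pselect (cfq_base t r0 x (qlen (ket z : qvec R))).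
  rewrite (base x (size z))//; last by right.
  by apply: Hg; rewrite tens_ket -yE -sy; exact: Hsp_ket.
have [x' nx' dx] := dP _ nx.
rewrite (step x x' (size z))//.
have sx : size x' = size x.
  have := Hd _ _ (@Hsp_ket R (x ++ r0)) (x' ++ r0).
  rewrite dx /ket eqxx => /(_ (oner_neq0 _)).
  by rewrite !size_cat => /addIn.
have tz : (1 < size z)%N.
  rewrite ltnNge; apply/negP => le; apply: nb; apply: Or32.
  by rewrite qlen_ket (leq_trans le).
have NE : N = (size r0 + size x + size z)%N.
  by rewrite -sy yE !size_cat (addnC (size r0)).
apply: Hsp_sum => u; apply: Hsp_sum => v.
have Hzeta : Hsp (size x + size z)
    (zeta F (p u) (f u) u (x' ++ r0) (ket z)).
  apply: Hsp_sum => s.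
  set m := mfun (p u) (qlen (ket z : qvec R)).
  have mz : (m < size z)%N.
    rewrite /m qlen_ket /mfun /LH /RH; have := odd_double_half (size z).
    by case: (p u); rewrite ?uphalf_half; lia.
  have -> : (size x + size z = (size x + m) + (size z - m))%N.
    by rewrite -addnA subnKC// ltnW.
  apply: Hsp_tens; last first.
    by have := @Hsp_bra _ _ (tval s) _ (@Hpres_pfun _ (p u) _ _ Hz); rewrite size_tuple.
  have Hb : Hsp (size x + m) (bra u (ket (x' ++ r0) : qvec R) ⊗ ket s).
    apply: Hsp_tens; last by have := @Hsp_ket R s; rewrite size_tuple.
    have := @Hsp_bra _ _ (tval u) _ (@Hsp_ket R (x' ++ r0)).
    by rewrite size_cat size_tuple addnK sx.
  case: (f u) => //.
  have lN : (size x + m < N)%N by rewrite NE; lia.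
  have [pu|npu] := boolP (prefix u (x' ++ r0)); last first.
    suff -> : bra u (ket (x' ++ r0) : qvec R) ⊗ ket s = 0.
      by rewrite F0; exact: Hsp0.
    apply/funext => w; rewrite tens_ketr /bra /ket; case: ifP => // _.
    case: eqP => // e; case/negP: npu; rewrite -e; exact: prefix_prefix.
  case/prefixP: pu Hb => y' -> Hb; rewrite bra_ket tens_ket in Hb *.
  have sy' : size (y' ++ s) = (size x + m)%N.
    by apply: Hb; rewrite /ket eqxx oner_neq0.
  by apply: IH.
have lv : (size v <= size x + size z)%N.
  rewrite size_tuple; apply: leq_trans (leq_addr _ _).
  have [e|/eqP nz] := eqVneq (bra u (ket (x ++ r0) : qvec R)) 0.
    by rewrite e qlen0.
  rewrite (qlenE (@Hsp_bra _ _ (tval u) _ (@Hsp_ket R (x ++ r0))) nz).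
  by rewrite size_cat size_tuple addnK.
have -> : N = ((size r0 + size v) + (size x + size z - size v))%N.
  by rewrite -[RHS]addnA subnKC// addnA.
apply: Hsp_tens; last by apply: Hpres_pfunV; exact: Hsp_bra.
apply: Hh; rewrite tens_ket -[X in (X + _)%N](size_tuple u) -size_cat.
exact: Hsp_ket.
Qed.

(* A [qfun] is defined on all families of amplitudes, but only its values on
   the spaces [Hsp n] matter: all constructions stay within them. *)
Lemma EQS_Hpres {R : realType} (K : set R[i]) cs ms f :
  EQS K cs ms f -> Hpres f.
Proof.
have B a b n (phi : qvec R) (h : qfun R) : Hpres h ->
    Hsp n phi -> Hsp n (ket [:: a] ⊗ h (bra [:: b] phi)).
  by move=> Hh H; apply: Hsp_tens_bra => //; exact: (@Hsp_ket _ [:: a]).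
elim=> {cs ms f}.
- by move=> cs ms n phi.
- move=> cs ms th _ _ n phi H.
  by apply: HspD; [|apply: HspZ]; exact: (B _ _ _ _ id).
- move=> cs ms th _ _ n phi H; apply: HspD; first exact: HspZ.
  by apply: HspZ; apply: HspD; [|apply: HspN]; exact: (B _ _ _ _ id).
- by move=> cs ms n phi H; apply: HspD; exact: (B _ _ _ _ id).
- move=> cs ms n phi H; rewrite /SWAP; case: ifP => // _.
  apply: Hsp_sum => a; apply: Hsp_sum => b.
  by apply: (@Hsp_tens_bra _ _ _ _ _ id) => //; exact: (@Hsp_ket _ [:: a; b]).
- by move=> cs a n phi H; exact: (B _ _ _ _ id).
- by move=> cs ms g h _ Hg _ Hh n phi H; apply/Hg/Hh.
- move=> cs ms g h _ Hg _ Hh n phi H; rewrite /Branch; case: ifP => // _.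
  by apply: HspD; exact: B.
- move=> ms r0 g h _ _ Hg _ Hh n phi H; rewrite /CodeSKIPp; case: ifP => // _.
  apply: Hsp_sum => x; apply: Hsp_tens_bra => //; apply: Hg; exact: Hsp_ket.
- move=> ms r0 g h _ _ Hg _ Hh n phi H; rewrite /CodeSKIPm; case: ifP => // _.
  apply: Hsp_sum => x; apply: Hsp_tens_bra => //; apply: Hg; exact: Hsp_ket.
- by move=> cs ms t r0 d g h p f F t0 _ _ Hd _ Hg _ Hh dP; exact: CFQRec_Hpres.
Qed.

(* Main.v *)
Require Import Defs.
From HB Require Import structures.
From mathcomp Require Import all_boot all_order all_algebra.
From mathcomp Require Import all_classical all_reals all_analysis.
From mathcomp Require Import complex.
From mathcomp Require Import zify.

Set Implicit Arguments.
Unset Strict Implicit.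
Unset Printing Implicit Defensive.

Import Order.TTheory GRing.Theory Num.Theory.
Local Open Scope classical_set_scope.
Local Open Scope ring_scope.
Local Open Scope complex_scope.

(** A single recursion with r0 = 111 does the search. After skipping the first
   two blocks of the input, the code in front of s has k blocks, namely the
   blocks of x_3, ..., x_k, the end marker and the block of b; this is the
   longest code that is not yet a base case for |s| = 2^k, and k - 1 halvings
   of s leave two bits in front of which only the block of b remains. The i-th
   halving must then be steered by x_i, which sits two blocks before the i-th
   block of that code. A reversible gate [carry] therefore records the bit of
   a block in the block two places further on: 00y becomes 0vy, and the marker
   011 becomes 10w with w = 1 - v, so that the steering bit v can be read off
   either form and 111 is never created nor changed. Applied before the
   recursion, [carry] brings x_1 and x_2 into the code; used as d, it prepares
   the block two levels further down while the leading block, which decides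
   the branch, stays fixed; its inverse, used as h, undoes it on the way back.
   At the bottom the block 0vb is followed by 111 and two bits of s, and b is
   xored with the bit selected by v. *)

(** * Linearity on the spaces of fixed length *)

Section Linearity.
Context {R : realType}.
Implicit Types (phi psi : qvec R) (f g : qfun R) (s u v w x y z : seq bool).

Definition linear_on (n : nat) f : Prop :=
  forall a phi psi, Hsp n phi -> Hsp n psi ->
    f (a *q phi + psi) = a *q f phi + f psi.

Lemma qscaleE a phi w : (a *q phi) w = a * phi w.
Proof. by []. Qed.

Lemma qaddE phi psi w : (phi + psi) w = phi w + psi w.
Proof. by []. Qed.

Lemma qscaleN1 phi : -1 *q phi + phi = 0.
Proof. by apply/funext => w; rewrite qaddE qscaleE mulN1r addNr. Qed.

Lemma tens_linear (a : R[i]) phi psi chi :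
  chi ⊗ (a *q phi + psi) = a *q (chi ⊗ phi) + chi ⊗ psi.
Proof.
apply/funext => w; rewrite qaddE qscaleE /tens mulr_sumr -big_split/=.
by apply: eq_bigr => i _; rewrite qaddE qscaleE mulrDr mulrCA.
Qed.

Lemma tens0l phi : 0 ⊗ phi = 0 :> qvec R.
Proof. by apply/funext => w; rewrite /tens big1// => i _; rewrite mul0r. Qed.

Lemma bra0 u : bra u 0 = 0 :> qvec R.
Proof. by []. Qed.

Lemma bra_ket_cat u s z : size u = size s ->
  bra u (ket (s ++ z) : qvec R) = if s == u then ket z else 0.
Proof.
move=> e; apply/funext => w; rewrite /bra /ket eqseq_cat// eq_sym.
by case: eqP => // _.
Qed.

Lemma bra_ket_nprefix u s : ~~ prefix u s -> bra u (ket s : qvec R) = 0.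
Proof.
move=> np; apply/funext => w; rewrite /bra /ket; case: eqP => // e.
by case/negP: np; rewrite -e prefix_prefix.
Qed.

Lemma linear_on0 n f : linear_on n f -> f 0 = 0.
Proof.
move=> lin; have := lin (-1) 0 0 (@Hsp0 _ _) (@Hsp0 _ _).
by rewrite !qscaleN1.
Qed.

Lemma linear_on_ket n f phi : linear_on n f -> Hsp n phi ->
  f phi = \sum_(s : n.-tuple bool) phi s *q f (ket s).
Proof.
move=> lin H; rewrite {1}(ket_sum H).
suff [_] : Hsp n (\sum_(s : n.-tuple bool) phi s *q ket s) /\
  f (\sum_(s : n.-tuple bool) phi s *q ket s) =
  \sum_(s : n.-tuple bool) phi s *q f (ket s) by [].
elim: (index_enum _) => [|s r [H1 H2]].
  by rewrite !big_nil (linear_on0 lin); split => //; exact: Hsp0.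
have Hk : Hsp n (ket s : qvec R) by have := @Hsp_ket R s; rewrite size_tuple.
by rewrite !big_cons lin// H2; split => //; apply: HspD => //; exact: HspZ.
Qed.

Lemma linear_on_ext n f g : linear_on n f -> linear_on n g ->
  (forall s, size s = n -> f (ket s) = g (ket s)) ->
  forall phi, Hsp n phi -> f phi = g phi.
Proof.
move=> lf lg e phi H; rewrite (linear_on_ket lf H) (linear_on_ket lg H).
by apply: eq_bigr => s _; rewrite e// size_tuple.
Qed.

Lemma linear_on_sum (I : finType) n (E : I -> qfun R) :
  (forall i, linear_on n (E i)) -> linear_on n (fun phi => \sum_i E i phi).
Proof.
move=> lin a phi psi H1 H2; rewrite (eq_bigr (fun i => a *q E i phi + E i psi)).
  rewrite big_split/=; congr (_ + _); apply/funext => w.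
  rewrite qscaleE !fct_sumE mulr_sumr.
  by apply: eq_bigr.
by move=> i _; exact: lin.
Qed.

Lemma linear_on_tens n chi f :
  linear_on n f -> linear_on n (fun phi => chi ⊗ f phi).
Proof. by move=> lin a phi psi H1 H2; rewrite lin// tens_linear. Qed.

Lemma linear_on_rotate n m : linear_on n (rotate m : qfun R).
Proof.
move=> a phi psi _ _; apply/funext => w; rewrite qaddE qscaleE /rotate !fct_sumE.
rewrite mulr_sumr -big_split/=; apply: eq_bigr => s _.
by rewrite !tens_ketr; case: ifP => _; rewrite ?mulr0 ?addr0.
Qed.

(** The test on [qlen] is a test on [n] except at the null vector, whose [qlen] is 0; there both
    branches give 0. *)
Lemma linear_on_qlen n f : linear_on n f ->
  linear_on n (fun phi => if (qlen phi <= 1)%N then phi else f phi).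
Proof.
move=> lin.
suff H phi : Hsp n phi -> (if (qlen phi <= 1)%N then phi else f phi) =
    if (n <= 1)%N then phi else f phi.
  move=> a phi psi H1 H2; rewrite !H//; last by apply: HspD => //; exact: HspZ.
  by case: ifP => // _; exact: lin.
move=> Hp; have [->|/eqP nz] := eqVneq phi 0; last by rewrite (qlenE Hp nz).
by rewrite qlen0 (linear_on0 lin); case: ifP.
Qed.

Lemma linear_on_eq n f g : (forall phi, Hsp n phi -> f phi = g phi) ->
  linear_on n g -> linear_on n f.
Proof.
move=> e lin a phi psi H1 H2; rewrite !e//; first exact: lin.
by apply: HspD => //; exact: HspZ.
Qed.

Lemma linear_on_pfun n b : linear_on n (pfun b : qfun R).
Proof.
case: b => //=; apply: (@linear_on_eq _ _
  (fun phi => if (qlen phi <= 1)%N then phi else rotate (LH n) phi)).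
  move=> phi H; rewrite /HalfSWAP; case: ifP => // l1; rewrite (qlenE H)// => e.
  by rewrite e qlen0 in l1.
exact/linear_on_qlen/linear_on_rotate.
Qed.

Lemma linear_on_pfunV n b : linear_on n (pfunV b : qfun R).
Proof.
case: b => //=; apply: (@linear_on_eq _ _
  (fun phi => if (qlen phi <= 1)%N then phi else rotate (RH n) phi)).
  move=> phi H; rewrite /HalfSWAPV; case: ifP => // l1; rewrite (qlenE H)// => e.
  by rewrite e qlen0 in l1.
exact/linear_on_qlen/linear_on_rotate.
Qed.

Lemma rotate_ket s1 s2 :
  rotate (size s1) (ket (s1 ++ s2)) = ket (s2 ++ s1) :> qvec R.
Proof.
apply/funext => w.
rewrite (rotateE _ (@Hsp_ket _ (s1 ++ s2))) ?size_cat ?leq_addr// addKn.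
case: ifP => [/eqP sw|ns]; last first.
  by rewrite /ket; case: eqP => // e; rewrite e size_cat addnC eqxx in ns.
have e1 : size (drop (size s2) w) = size s1 by rewrite size_drop sw addnK.
have e2 : size (take (size s2) w) = size s2 by rewrite size_takel// sw leq_addl.
rewrite -[w in RHS](cat_take_drop (size s2) w) /ket (eqseq_cat _ _ e1).
by rewrite (eqseq_cat _ _ e2) andbC.
Qed.

Lemma pfun_ket b z :
  pfun b (ket z) = ket (if b then drop (LH (size z)) z ++ take (LH (size z)) z
                        else z) :> qvec R.
Proof.
case: b => //=; rewrite /HalfSWAP qlen_ket.
case: ifP => [|_]; first by case: z => [|a []].
have := rotate_ket (take (LH (size z)) z) (drop (LH (size z)) z).
rewrite cat_take_drop size_takel// /LH uphalf_half.
by have := odd_double_half (size z); lia.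
Qed.

End Linearity.

(** * Existence of solutions of the CFQRec equations *)

Section LinearExtension.
Context {R : realType}.
Implicit Types (phi psi : qvec R) (f g : qfun R) (k : seq bool -> qvec R).

Lemma linear_on_comp m n f g : linear_on n f ->
  (forall phi, Hsp n phi -> Hsp m (f phi)) -> linear_on m g ->
  linear_on n (g \o f).
Proof. by move=> lf Hf lg a phi psi H1 H2 /=; rewrite lf// lg//; exact: Hf. Qed.

Lemma ket_inj : injective (@ket R).
Proof.
move=> s u /(congr1 (fun phi : qvec R => phi s)); rewrite /ket eqxx.
by case: eqP => // _ /eqP; rewrite oner_eq0.
Qed.

(** Linear extension from basis vectors. Summing only over strings as long as [w] keeps the sum
    finite and the map length-preserving for every [k]; components of [k s] of another length are
    dropped. *)
Definition extend k : qfun R :=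
  fun phi w => \sum_(s : (size w).-tuple bool) phi s * k s w.

Lemma linear_on_extend n k : linear_on n (extend k).
Proof.
move=> a phi psi _ _; apply/funext => w; rewrite qaddE qscaleE /extend.
rewrite mulr_sumr -big_split/=; apply: eq_bigr => s _.
by rewrite qaddE qscaleE mulrDl mulrA.
Qed.

Lemma Hpres_extend k : Hpres (extend k).
Proof.
move=> n phi H w nz; apply/eqP; apply: contraNT nz => sw; apply/eqP.
rewrite /extend big1// => s _.
have [->|/H] := eqVneq (phi s) 0; first by rewrite mul0r.
by rewrite size_tuple => e; rewrite e eqxx in sw.
Qed.

Lemma extend_ket k s : Hsp (size s) (k s) -> extend k (ket s) = k s.
Proof.
move=> H; apply/funext => w; have [sw|sw] := eqVneq (size w) (size s).
  have sz : size s == size w by rewrite sw.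
  rewrite /extend (bigD1 (Tuple sz))//= big1 ?addr0; first by rewrite /ket eqxx mul1r.
  move=> u nu; rewrite /ket; case: eqP => [e|]; last by rewrite mul0r.
  by case/eqP: nu; exact/val_inj.
have zero (phi : qvec R) : Hsp (size s) phi -> phi w = 0.
  by move=> Hphi; apply/eqP; apply: contraNT sw => /Hphi ->.
by rewrite !zero//; apply: Hpres_extend; exact: Hsp_ket.
Qed.

End LinearExtension.

Lemma mfun_leq b n : (Defs.mfun b n <= n)%N.
Proof.
by rewrite /Defs.mfun /LH /RH; have := odd_double_half n; case: b; rewrite ?uphalf_half; lia.
Qed.

Section CFQRecExistence.
Context {R : realType} (t : nat) (r0 : seq bool) (d g h : qfun R).
Context (p f : (size r0).-tuple bool -> bool).
Implicit Types (phi psi : qvec R) (F G : qfun R) (x y z : seq bool).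

(** [zeta] with the length [n] as a parameter: [qlen] drops to 0 at the null vector, whereas this
    version is visibly linear in [phi]. *)
Definition zeta_at F n pu fu (u y : seq bool) phi : qvec R :=
  \sum_(s : (Defs.mfun pu n).-tuple bool)
    (if fu then F else id) (bra u (ket y) ⊗ ket s) ⊗ bra s (pfun pu phi).

(** The right-hand side of [cfq_stepE], again with the length of the tail fixed. *)
Definition rec_value F n x x' : qfun R := fun phi =>
  \sum_(u : (size r0).-tuple bool)
   \sum_(v : (qlen (bra u (ket (x ++ r0) : qvec R))).-tuple bool)
     h (ket u ⊗ ket v) ⊗
       pfunV (p u) (bra v (zeta_at F n (p u) (f u) u (x' ++ r0) phi)).

Lemma linear_on_zeta_at F n pu fu u y : linear_on n (zeta_at F n pu fu u y).
Proof.
apply: linear_on_sum => s; apply: linear_on_tens => a phi psi H1 H2.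
by rewrite (linear_on_pfun _ _ H1 H2).
Qed.

Lemma Hsp_zeta_at F n pu fu (u : (size r0).-tuple bool) x phi :
  Hpres F -> Hsp n phi ->
  Hsp (size x + n) (zeta_at F n pu fu u (x ++ r0) phi).
Proof.
move=> HF H; apply: Hsp_sum => s.
have -> : (size x + n = (size x + Defs.mfun pu n) + (n - Defs.mfun pu n))%N.
  by rewrite -addnA subnKC// mfun_leq.
apply: Hsp_tens; last first.
  by have := @Hsp_bra _ _ (tval s) _ (@Hpres_pfun _ pu _ _ H); rewrite size_tuple.
have Hb : Hsp (size x + Defs.mfun pu n) (bra u (ket (x ++ r0) : qvec R) ⊗ ket s).
  apply: Hsp_tens; last by have := @Hsp_ket R s; rewrite size_tuple.
  by have := @Hsp_bra _ _ (tval u) _ (@Hsp_ket R (x ++ r0)); rewrite size_cat size_tuple addnK.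
by case: fu => //; exact: HF.
Qed.

Lemma linear_on_rec_value F n x x' : Hpres F -> linear_on n (rec_value F n x x').
Proof.
move=> HF; apply: linear_on_sum => u; apply: linear_on_sum => v.
apply: linear_on_tens.
apply: (@linear_on_comp _ (size x' + n - size v) n
  (fun phi => bra v (zeta_at F n (p u) (f u) u (x' ++ r0) phi))).
- by move=> a phi psi H1 H2; rewrite (linear_on_zeta_at _ _ _ _ _ _ H1 H2).
- by move=> phi H; apply/Hsp_bra/Hsp_zeta_at.
- exact: linear_on_pfunV.
Qed.

Lemma Hsp_rec_value F n x x' phi : Hpres F -> Hpres h -> size x' = size x ->
  Hsp n phi -> Hsp (size (x ++ r0) + n) (rec_value F n x x' phi).
Proof.
move=> HF Hh sx H; apply: Hsp_sum => u; apply: Hsp_sum => v.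
(* If [u] does not lead the code, [bra u] gives the null vector and [v] has length 0 instead of
   [size x]. *)
have lv : (size v <= size x + n)%N.
  rewrite size_tuple; apply: leq_trans (leq_addr _ _).
  have [->|/eqP nz] := eqVneq (bra u (ket (x ++ r0) : qvec R)) 0.
    by rewrite qlen0.
  by rewrite (qlenE (@Hsp_bra _ _ (tval u) _ (@Hsp_ket R (x ++ r0))) nz) size_cat size_tuple addnK.
have -> : (size (x ++ r0) + n = size (u ++ v) + (size x + n - size v))%N.
  by have := size_tuple u; rewrite !size_cat; lia.
apply: Hsp_tens; first by apply: Hh; rewrite tens_ket; exact: Hsp_ket.
by apply/Hpres_pfunV/Hsp_bra; rewrite -sx; exact: Hsp_zeta_at.
Qed.

(** Recursive calls lose the block [u] and keep at most [n] bits of the tail, so their arguments are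
    shorter by at least [size r0]. A mismatched [u] calls [F] on the null vector, whence the
    condition [F 0 = G 0]. *)
Lemma rec_value_ext F G n x x' phi : size x' = size x -> r0 <> [::] ->
  F 0 = G 0 ->
  (forall y, (size y < size (x ++ r0) + n)%N -> F (ket y) = G (ket y)) ->
  rec_value F n x x' phi = rec_value G n x x' phi.
Proof.
move=> sx nr0 e0 e; apply: eq_bigr => u _; apply: eq_bigr => v _.
congr (_ ⊗ pfunV _ (bra _ _)); apply: eq_bigr => s _; congr (_ ⊗ _).
case: (f u) => //; have [pu|/bra_ket_nprefix ->] := boolP (prefix u (x' ++ r0)).
  case/prefixP: pu => y' yE; rewrite yE bra_ket tens_ket; apply: e.
  have := congr1 size yE; rewrite !size_cat !size_tuple sx.
  have := mfun_leq (p u) n; have : (0 < size r0)%N by case: (r0) nr0.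
  move=> pos le ->; apply: (@leq_ltn_trans (size y' + n)); first by rewrite leq_add2l.
  by rewrite -addnA -[X in (X < _)%N]add0n ltn_add2r.
by rewrite tens0l.
Qed.

Definition code_split y : set (seq bool) :=
  [set x | (x = [::] \/ NON r0 x) /\ prefix (x ++ r0) y].

(** If [x1] were shorter than [x2], the [r0] after [x1] would be an aligned block of [x2], which
    [NON] forbids. *)
Lemma code_split_uniq y x1 x2 : r0 <> [::] ->
  code_split y x1 -> code_split y x2 -> x1 = x2.
Proof.
move=> nr0; wlog le12 : x1 x2 / (size x1 <= size x2)%N.
  by move=> W H1 H2; case: (leqP (size x1) (size x2)) => [|/ltnW] le;
    [|symmetry]; exact: W.
move=> [c1 /prefixP[z1 e1]] [c2 /prefixP[z2 e2]].
have pos : (0 < size r0)%N by case: (r0) nr0.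
have dv x : x = [::] \/ NON r0 x -> (size r0 %| size x)%N.
  by case=> [->|[]]//; rewrite dvdn0.
have [eq12|lt12] := eqVneq (size x1) (size x2).
  move: e2; rewrite e1 -!catA => /eqP; rewrite eqseq_cat//.
  by case/andP => /eqP.
have {le12}lt12 : (size x1 < size x2)%N by rewrite ltn_neqAle lt12.
case: c2 (dv _ c2) => [e|[_ _ n2]] d2; first by rewrite e in lt12.
have d1 := dv _ c1.
case: (n2 (size x1 %/ size r0)%N).
  by rewrite ltn_divRL// divnK.
rewrite divnK//; move: (e1); rewrite e2 -!catA => e3.
have := congr1 (take (size r0) \o drop (size x1)) e3 => /=.
rewrite (drop_size_cat _ (erefl (size x1))) (take_size_cat _ (erefl (size r0))).
rewrite drop_cat lt12 takel_cat//.
rewrite size_drop; apply: dvdn_leq; first by rewrite subn_gt0.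
exact: dvdn_sub.
Qed.

(* The recursion of CFQRec on basis vectors, cut at depth N; vectors of length
   less than N do not feel the cut ([approx_stable]). *)
Fixpoint approx (N : nat) (y : seq bool) : qvec R :=
  if N is N'.+1 then
    if `[< code_split y !=set0 >] then
      let x := xget [::] (code_split y) in
      let z := drop (size (x ++ r0)) y in
      if `[< cfq_base t r0 x (size z) >] then g (ket y)
      else rec_value (extend (approx N')) (size z) x
        (xget [::] [set x' | NON r0 x' /\ d (ket (x ++ r0)) = ket (x' ++ r0)])
        (ket z)
    else ket y
  else ket y.

Definition cfq_sol : qfun R := extend (fun y => approx (size y).+1 y).

Hypotheses (r0_neq0 : r0 <> [::]) (Hd : Hpres d) (Hg : Hpres g) (Hh : Hpres h).
Hypothesis g_linear : forall n, linear_on n g.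
Hypothesis d_code : forall x, NON r0 x ->
  exists2 x', NON r0 x' & d (ket (x ++ r0)) = ket (x' ++ r0).

Lemma d_size x x' : d (ket (x ++ r0)) = ket (x' ++ r0) -> size x' = size x.
Proof.
move=> dx; have := @Hd _ _ (@Hsp_ket R (x ++ r0)) (x' ++ r0).
rewrite dx /ket eqxx => /(_ (oner_neq0 _)).
by rewrite !size_cat => /addIn.
Qed.

(** Case analysis on [approx] that exposes the split and the image under [d] in place of the [xget]
    choices. *)
Variant approx_spec N y : qvec R -> Prop :=
| ApproxBase x z of y = (x ++ r0) ++ z & code_split y x &
    cfq_base t r0 x (size z) : approx_spec N y (g (ket y))
| ApproxStep x x' z of y = (x ++ r0) ++ z & NON r0 x & NON r0 x' &
    d (ket (x ++ r0)) = ket (x' ++ r0) & ~ cfq_base t r0 x (size z) :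
    approx_spec N y (rec_value (extend (approx N)) (size z) x x' (ket z))
| ApproxRest of ~ (code_split y !=set0) : approx_spec N y (ket y).

Lemma approxP N y : approx_spec N y (approx N.+1 y).
Proof.
rewrite /=; case: asboolP => [|h0]; last exact: ApproxRest.
case=> x0 c0; have c := xgetPex [::] (ex_intro _ x0 c0).
set x := xget _ _ in c *.
have yE : y = (x ++ r0) ++ drop (size (x ++ r0)) y.
  by case: c => _ /prefixP[z yE]; rewrite {2}yE drop_size_cat.
case: asboolP => b; first exact: ApproxBase b.
have nx : NON r0 x by case: c => [[e|//]]; case: b; apply: Or31.
have [x1 n1 e1] := d_code nx.
have [n' e'] := @xgetPex _ [::]
  [set x' | NON r0 x' /\ d (ket (x ++ r0)) = ket (x' ++ r0)]
  (ex_intro _ x1 (conj n1 e1)).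
exact: ApproxStep.
Qed.

Lemma Hsp_approx N y : Hsp (size y) (approx N y).
Proof.
case: N => [|N]; first exact: Hsp_ket.
case: approxP => [x z _ _ _|x x' z {1}-> _ _ dx _|_].
- exact/Hg/Hsp_ket.
- rewrite size_cat; apply: Hsp_rec_value => //; first exact: Hpres_extend.
    exact: d_size dx.
  exact: Hsp_ket.
- exact: Hsp_ket.
Qed.

Lemma extend_approx0 k : extend k 0 = 0 :> qvec R.
Proof. exact/Hpres0/Hpres_extend. Qed.

Lemma approx_stable N M y : (size y < N)%N -> (size y < M)%N ->
  approx N y = approx M y.
Proof.
elim: N M y => // N IH [//|M] y yN yM /=; case: asboolP => // c.
case: asboolP => // b; set x := xget _ (code_split y); set z := drop _ _.
set X := [set x' | _].
have [_ /prefixP[z' yE]] := xgetPex [::] c; rewrite -/x in yE.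
have zE : z = z' by rewrite /z [X in drop _ X]yE drop_size_cat.
have nx : NON r0 x.
  have [[e|//] _] := xgetPex [::] c; case: b; exact: Or31.
have [x1 n1 e1] := d_code nx.
have [_ dx] := @xgetPex _ [::] X (ex_intro _ x1 (conj n1 e1)).
apply: rec_value_ext => //; first exact: d_size dx.
  by rewrite !extend_approx0.
have zs : (size (x ++ r0) + size z = size y)%N by rewrite zE yE -size_cat.
move=> w; rewrite zs => lt.
rewrite !extend_ket; [|exact: Hsp_approx..].
by apply: IH; lia.
Qed.

Lemma cfq_sol_ket y : cfq_sol (ket y) = approx (size y).+1 y.
Proof. by rewrite /cfq_sol extend_ket//; exact: Hsp_approx. Qed.

Lemma cfq_sol_approx N y : (size y < N)%N ->
  extend (approx N) (ket y) = cfq_sol (ket y).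
Proof.
move=> yN; rewrite cfq_sol_ket extend_ket; last exact: Hsp_approx.
exact: approx_stable.
Qed.

Lemma code_split_cat x z : x = [::] \/ NON r0 x -> code_split ((x ++ r0) ++ z) x.
Proof. by split => //; exact: prefix_prefix. Qed.

Lemma ket_code_linear F n x : (forall m, linear_on m F) ->
  linear_on n (fun phi => F (ket (x ++ r0) ⊗ phi)).
Proof.
move=> lF; apply: (@linear_on_comp _ (size (x ++ r0) + n)) => //.
  exact: (@linear_on_tens _ _ _ id).
by move=> phi H; apply: Hsp_tens => //; exact: Hsp_ket.
Qed.

(** For a fixed code and tail length, both sides of the base and step equations are linear in the
    tail, so comparing them on basis vectors suffices; there uniqueness of the split selects the
    right clause of [approx]. *)
Theorem is_CFQRec_cfq_sol : is_CFQRec t r0 d g h p f cfq_sol.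
Proof.
have lin n : linear_on n cfq_sol by exact: linear_on_extend.
split => //.
(* The null vector has [qlen] 0 rather than [n], so it is set apart; both sides vanish on it. *)
- move=> x n phi xP H; have [->|/eqP nz] := eqVneq phi 0.
    by rewrite tens0 (linear_on0 (lin 0%N)) (linear_on0 (@g_linear 0%N)).
  rewrite (qlenE H nz) => b.
  refine (linear_on_ext (@ket_code_linear cfq_sol n x lin)
    (@ket_code_linear g n x g_linear) _ H).
  move=> s sn; rewrite tens_ket cfq_sol_ket.
  have c := code_split_cat s xP.
  case: approxP => // [x1 x' z yE n1 n' dx nb|]; last by case; exists x.
  have e1 : x1 = x.
    by apply: code_split_uniq c => //; rewrite yE; apply: code_split_cat; right.
  case: nb; rewrite e1; move/eqP: yE; rewrite e1 eqseq_cat//.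
  by case/andP => _ /eqP <-; rewrite sn.
- move=> x x' n phi nx nx' dx H nb.
  (* Length 0 is at most [t], so the null vector is a base case and cannot occur here. *)
  have nz : phi <> 0 by move=> e; apply: nb; rewrite e qlen0; exact: Or32.
  change (cfq_sol (ket (x ++ r0) ⊗ phi) = rec_value cfq_sol (qlen phi) x x' phi).
  rewrite (qlenE H nz) in nb *.
  refine (linear_on_ext (@ket_code_linear cfq_sol n x lin)
    (@linear_on_rec_value cfq_sol n x x' (@Hpres_extend _ _)) _ H).
  move=> s sn; rewrite tens_ket cfq_sol_ket.
  have c := code_split_cat s (or_intror nx).
  case: approxP => [x1 z yE c1 b|x1 x2 z yE n1 n2 dx1 nb1|]; last by case; exists x.
    have e1 : x1 = x by exact: code_split_uniq c1 c.
    case: nb; rewrite e1 in yE b; move/eqP: yE; rewrite eqseq_cat//.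
    by case/andP => _ /eqP e; rewrite -sn e.
  have e1 : x1 = x.
    by apply: code_split_uniq c => //; rewrite yE; apply: code_split_cat; right.
  rewrite {x1}e1 in yE n1 dx1 nb1 *; move/eqP: yE; rewrite eqseq_cat// eqxx/=.
  move/eqP => <-; rewrite sn.
  (* The ket [d (ket (x ++ r0))] determines its code, so the choice made by [approx] is the given
     [x']. *)
  have e2 : x2 = x'.
    have sx : size x2 = size x' by rewrite (d_size dx1) (d_size dx).
    have /ket_inj/eqP := etrans (esym dx1) dx.
    by rewrite eqseq_cat// eqxx andbT => /eqP.
  rewrite e2; apply: rec_value_ext => //; first exact: d_size dx.
    by rewrite extend_approx0 (linear_on0 (lin 0%N)).
  by move=> y; rewrite -sn -size_cat => /cfq_sol_approx.
- move=> y np; move=> /eqP e; rewrite cfq_sol_ket.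
  suff nc : ~ (code_split y !=set0).
    case: approxP => // [x z yE c _|x x' z yE n1 _ _ _]; case: nc; exists x => //.
    by rewrite yE; apply: code_split_cat; right.
  case=> x [[->|nx] /prefixP[z yE]].
    by case/negP: np; rewrite yE; exact: prefix_prefix.
  suff /set0P : NONv r0 (ket y : qvec R) !=set0 by rewrite e.
  exists x; split => //.
  by rewrite yE bra_ket; exact: ket_neq0.
Qed.

End CFQRecExistence.

(** * Classical gates *)

Inductive gate : Type :=
| Gid
| Gnot
| Gswap
| Gcomp of gate & gate
| Gbranch of gate & gate.

(* On words of length at most 1, Branch is the identity. On the empty word,
   NOT yields the null vector, so [act] is meaningful on nonempty words only. *)
Fixpoint act (c : gate) (w : seq bool) : seq bool :=
  match c, w with
  | Gnot, a :: w' => ~~ a :: w'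
  | Gswap, a :: b :: w' => b :: a :: w'
  | Gcomp c1 c2, _ => act c1 (act c2 w)
  | Gbranch c0 c1, a :: ((_ :: _) as w') =>
      a :: (if a then act c1 w' else act c0 w')
  | _, _ => w
  end.

Lemma size_act c w : size (act c w) = size w.
Proof.
elim: c w => [|||c1 IH1 c2 IH2|c0 IH0 c1 IH1] [|a [|b w]]//=.
- by rewrite IH1 IH2.
- by rewrite IH1 IH2.
- by rewrite IH1 IH2.
- by case: a; rewrite ?IH0 ?IH1.
Qed.

(** Branching to the same gate on both sides skips a bit, so [c] acts behind the first [n] bits. *)
Definition gpeel (n : nat) (c : gate) : gate := iter n (fun c => Gbranch c c) c.

Section GateSemantics.
Context {R : realType}.
Implicit Types (phi psi : qvec R) (f g : qfun R) (s u v w x y z : seq bool).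

Fixpoint den (c : gate) : qfun R :=
  match c with
  | Gid => id
  | Gnot => NOT
  | Gswap => SWAP
  | Gcomp c1 c2 => den c1 \o den c2
  | Gbranch c0 c1 => Branch (den c0) (den c1)
  end.

Lemma EQS_den (K : set R[i]) cs ms c : EQS K cs ms (den c).
Proof.
elim: c => [|||c1 IH1 c2 IH2|c0 IH0 c1 IH1] /=.
- exact: EQS_I.
- exact: EQS_NOT.
- exact: EQS_SWAP.
- exact: EQS_Compo.
- exact: EQS_Branch.
Qed.

Lemma Hpres_den c : Hpres (den c).
Proof. exact: EQS_Hpres (@EQS_den set0 true true c). Qed.

Lemma linear_onD n f g : linear_on n f -> linear_on n g ->
  linear_on n (fun phi => f phi + g phi).
Proof.
move=> lf lg a phi psi H1 H2; rewrite lf// lg// addrACA; congr (_ + _).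
by apply/funext => w; rewrite qaddE !qscaleE qaddE mulrDr.
Qed.

Lemma linear_on_tens_bra n u v f : (forall m, linear_on m f) ->
  linear_on n (fun phi => ket u ⊗ f (bra v phi)).
Proof.
move=> lf; apply: linear_on_tens.
apply: (@linear_on_comp _ (n - size v) n (bra v)) => // phi H.
exact: Hsp_bra.
Qed.

Lemma linear_on_den n c : linear_on n (den c).
Proof.
elim: c n => [|||c1 IH1 c2 IH2|c0 IH0 c1 IH1] n //=.
- by apply: linear_onD; apply: (@linear_on_tens_bra _ _ _ id).
- apply: linear_on_qlen; apply: linear_on_sum => a; apply: linear_on_sum => b.
  exact: (@linear_on_tens_bra _ _ _ id).
- by apply: (@linear_on_comp _ n) => // phi; exact: Hpres_den.
- by apply: linear_on_qlen; apply: linear_onD; exact: linear_on_tens_bra.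
Qed.

Lemma Branch_ket f g a w : w <> [::] -> f 0 = 0 -> g 0 = 0 ->
  Branch f g (ket (a :: w)) = ket [:: a] ⊗ (if a then g else f) (ket w).
Proof.
move=> nw f0 g0; rewrite /Branch qlen_ket/= ltnS leqNgt lt0n size_eq0.
move/eqP: nw => -> /=.
rewrite -[a :: w]cat1s !bra_ket_cat//.
by case: a; rewrite /= ?f0 ?g0 tens0 ?addr0 ?add0r.
Qed.

Lemma den_ket c w : w <> [::] -> den c (ket w) = ket (act c w).
Proof.
elim: c w => [|||c1 IH1 c2 IH2|c0 IH0 c1 IH1] [|a w]// _ /=.
- rewrite /NOT -[a :: w]cat1s !bra_ket_cat//.
  by case: a; rewrite /= tens0 ?addr0 ?add0r tens_ket.
- case: w => [|b w]; first by rewrite /SWAP qlen_ket.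
  have braE b' a' : bra [:: a'; b'] (ket [:: a, b & w]) =
      if [:: a; b] == [:: a'; b'] then ket w else 0 :> qvec R.
    exact: (@bra_ket_cat R [:: a'; b'] [:: a; b] w).
  rewrite /SWAP qlen_ket/= (bigD1 b)//= [X in _ + X]big1 => [|b' nb]; last first.
    rewrite big1// => a' _; rewrite braE !eqseq_cons.
    by rewrite [b == b']eq_sym (negbTE nb) andbF tens0.
  rewrite (bigD1 a)//= big1 => [|a' na]; last first.
    rewrite braE !eqseq_cons.
    by rewrite [a == a']eq_sym (negbTE na) tens0.
  by rewrite braE eqxx tens_ket !addr0.
- rewrite IH2// IH1// => e.
  by have := size_act c2 (a :: w); rewrite e.
- case: w => [|b w]; first by rewrite /Branch qlen_ket.
  rewrite Branch_ket ?(Hpres0 (@Hpres_den _))//.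
  by case: a; rewrite ?IH0 ?IH1// tens_ket.
Qed.

Definition peel (n : nat) f : qfun R := iter n (fun f => Branch f f) f.

Lemma peel0 n f : f 0 = 0 -> peel n f 0 = 0.
Proof.
by move=> f0; elim: n => //= n IH; rewrite /Branch qlen0.
Qed.

Lemma peel_ket n f u z z' : size u = n -> z <> [::] -> f 0 = 0 ->
  f (ket z) = ket z' -> peel n f (ket (u ++ z)) = ket (u ++ z').
Proof.
move=> su nz f0 fz; elim: u n su => [|a u IH] [|n]//= [su].
rewrite Branch_ket ?peel0//; last by case: (u) (z) nz => [[]|].
by rewrite if_same -/(peel n f) IH// tens_ket.
Qed.

End GateSemantics.

(** * One level of the recursion on basis vectors *)

Lemma EQS_peel (R : realType) (K : set R[i]) cs ms n f :
  EQS K cs ms f -> EQS K cs ms (peel n f).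
Proof. by move=> Hf; elim: n => //= n IH; exact: EQS_Branch. Qed.

(* The leading block [u] has to be the same before and after [d]: otherwise
   |v| = 0, and p_u^-1 would rotate the code together with the rest. *)
Lemma cfq_step_ket (R : realType) t r0 (d g h F : qfun R) p f
    (u : (size r0).-tuple bool) (y y' w z : seq bool) :
  is_CFQRec t r0 d g h p f F -> NON r0 (u ++ y) -> NON r0 (u ++ y') ->
  d (ket ((u ++ y) ++ r0)) = ket ((u ++ y') ++ r0) ->
  ~ cfq_base t r0 (u ++ y) (size z) -> f u -> size w = size (y ++ r0) ->
  let s := if p u then drop (LH (size z)) z else take (LH (size z)) z in
  F (ket ((y' ++ r0) ++ s)) = ket (w ++ s) ->
  F (ket (((u ++ y) ++ r0) ++ z)) = h (ket (u ++ w)) ⊗ ket z.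
Proof.
move=> H nx nx' dx nb fu sw s Fs.
have F0 : F 0 = 0 by apply: (@linear_on0 _ 0); exact: cfq_linear H 0%N.
rewrite -tens_ket (cfq_stepE H nx nx' dx (@Hsp_ket _ z)) ?qlen_ket//.
set q := p u in s Fs *.
set s' := if q then take (LH (size z)) z else drop (LH (size z)) z.
(* [HalfSWAP] brings the right half to the front, so in both cases the kept half [s] leads. *)
have pz : pfun q (ket z) = ket (s ++ s') :> qvec R.
  by rewrite pfun_ket /s /s'; case: (q) => //; rewrite cat_take_drop.
have pzV : pfunV q (ket (s ++ s')) = ket z :> qvec R.
  by rewrite -pz; case: (q) => //=; apply: HalfSWAPK; exact: Hsp_ket.
have ss : size s == Defs.mfun q (qlen (ket z : qvec R)).
  rewrite qlen_ket /s; case: (q); rewrite ?size_drop ?size_take /Defs.mfun /LH /RH;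
    have := odd_double_half (size z); rewrite uphalf_half.
    lia.
  by case: ltnP; lia.
(* A block [u1] other than [u] annihilates the code, so its summand is null. *)
rewrite (bigD1 u)//= [X in _ + X]big1 => [|u1 nu]; last first.
  rewrite big1// => v _.
  have -> : zeta F (p u1) (f u1) u1 ((u ++ y') ++ r0) (ket z) = 0.
    rewrite /zeta big1// => s1 _; rewrite -catA bra_ket_cat ?size_tuple//.
    have -> : (tval u == tval u1) = false.
      by apply/eqP => e; case/eqP: nu; exact/val_inj.
    by rewrite tens0l; case: (f u1); rewrite ?F0 tens0l.
  by rewrite bra0 (linear_on0 (@linear_on_pfunV R 0 _)) tens0.
(* Only the kept half survives the sum over strings, and the recursive call replaces the code in
   front of it by [w]. *)
have -> : zeta F q (f u) u ((u ++ y') ++ r0) (ket z) = ket (w ++ (s ++ s')).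
  rewrite /zeta pz (bigD1 (Tuple ss))//= big1 => [|s1 ns].
    by rewrite fu -catA bra_ket tens_ket Fs bra_ket tens_ket addr0 -catA.
  rewrite (@bra_ket_cat R s1 s s'); last by rewrite size_tuple (eqP ss).
  have -> : (s == tval s1) = false.
    by apply/eqP => e; case/eqP: ns; exact/val_inj.
  by rewrite tens0.
have sw' : size w == qlen (bra u (ket ((u ++ y) ++ r0) : qvec R)).
  by rewrite -catA bra_ket qlen_ket sw.
rewrite (bigD1 (Tuple sw'))//= big1 => [|v nv].
  by rewrite bra_ket pzV tens_ket !addr0.
rewrite (@bra_ket_cat R v w); last by rewrite size_tuple (eqP sw').
have -> : (w == tval v) = false.
  by apply/eqP => e; case/eqP: nv; exact/val_inj.
by rewrite (linear_on0 (@linear_on_pfunV R 0 _)) tens0.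
Qed.

(** * Codes and the gates acting on them *)

Lemma NON_cat r0 a y : r0 <> [::] -> size a = size r0 ->
  NON r0 (a ++ y) <-> a <> r0 /\ (y = [::] \/ NON r0 y).
Proof.
move=> nr0 sa; have pos : (0 < size r0)%N by case: (r0) nr0.
have dv : (size r0 %| size (a ++ y))%N = (size r0 %| size y)%N.
  by rewrite size_cat sa dvdn_addr.
have qd : (size (a ++ y) %/ size r0 = (size y %/ size r0).+1)%N.
  by rewrite size_cat sa divnDl// divnn pos add1n.
split=> [[_ d1 n1]|[na yP]].
  split.
    have := n1 0%N; rewrite qd mul0n drop0 take_size_cat// => n2.
    exact: n2.
  case: (eqVneq y [::]) => [|/eqP ny]; [by left|right]; split=> //.
    by rewrite -dv.
  move=> j lj; have := n1 j.+1; rewrite qd ltnS => /(_ lj).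
  by rewrite mulSn -sa addnC -drop_drop drop_size_cat.
split; first by case: (a) sa pos => [<-|].
  by rewrite dv; case: yP => [->|[]]//; rewrite dvdn0.
move=> [_|j]; first by rewrite mul0n drop0 take_size_cat.
rewrite qd ltnS mulSn -sa addnC -drop_drop drop_size_cat// sa.
by case: yP => [->|[_ _ n1 /n1//]]; rewrite div0n.
Qed.

Lemma NON_block r0 x : r0 <> [::] -> NON r0 x ->
  exists a y, [/\ x = a ++ y, size a = size r0, a <> r0 & y = [::] \/ NON r0 y].
Proof.
move=> nr0 nx; case: (nx) => /eqP; rewrite -size_eq0 -lt0n => sx dv _.
have sa : size (take (size r0) x) = size r0 by rewrite size_takel// dvdn_leq.
exists (take (size r0) x), (drop (size r0) x).
have := (@NON_cat r0 (take (size r0) x) (drop (size r0) x) nr0 sa).1.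
rewrite cat_take_drop => /(_ nx)[na yP].
by split => //; rewrite cat_take_drop.
Qed.

(** An involution on three-bit blocks: it flips the middle bit of 0bc and the last bit of 10c, and
    fixes 11c. *)
Definition flag : gate := Gbranch Gnot (Gbranch Gnot Gid).
(** The swap, common to both branches, turns the marker 011 into 101 and leaves 00y alone; [flag]
    then records a steering bit 1. *)
Definition carry : gate :=
  gpeel 2 (Gbranch (gpeel 3 Gswap) (gpeel 3 (Gcomp flag Gswap))).
Definition uncarry : gate :=
  gpeel 2 (Gbranch (gpeel 3 Gswap) (gpeel 3 (Gcomp Gswap flag))).

Lemma act_gpeel n c u z : size u = n -> z <> [::] ->
  act (gpeel n c) (u ++ z) = u ++ act c z.
Proof.
move=> su nz; elim: u n su => [|a u IH] [|n]// [su].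
rewrite !cat_cons -(IH n su); have : u ++ z <> [::] by case: (u) (z) nz => [[]|].
by case: (u ++ z) => //= b w _; rewrite if_same.
Qed.

Lemma act_branch c0 c1 v z : z <> [::] ->
  act (Gbranch c0 c1) (v :: z) = v :: act (if v then c1 else c0) z.
Proof. by case: z => // b z _; case: v. Qed.

Lemma act_carry a b v w z : size w = 3 -> z <> [::] ->
  act carry ([:: a; b; v] ++ w ++ z) =
  [:: a; b; v] ++ w ++ act (if v then Gcomp flag Gswap else Gswap) z.
Proof.
move=> sw nz; have nwz : w ++ z <> [::] by case: (w) sw.
rewrite (@act_gpeel 2 _ [:: a; b] (v :: w ++ z))// act_branch//.
by case: v; rewrite act_gpeel.
Qed.

Lemma act_uncarry a b v w z : size w = 3 -> z <> [::] ->
  act uncarry ([:: a; b; v] ++ w ++ z) =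
  [:: a; b; v] ++ w ++ act (if v then Gcomp Gswap flag else Gswap) z.
Proof.
move=> sw nz; have nwz : w ++ z <> [::] by case: (w) sw.
rewrite (@act_gpeel 2 _ [:: a; b] (v :: w ++ z))// act_branch//.
by case: v; rewrite act_gpeel.
Qed.

(** Xors into the first bit the one at distance [n.+1]: the base case is a controlled NOT conjugated
    by a swap, and each further swap brings the control one place closer. *)
Fixpoint xor_bit (n : nat) : gate :=
  if n is n'.+1 then
    Gcomp (gpeel n (Gswap)) (Gcomp (xor_bit n') (gpeel n Gswap))
  else Gcomp Gswap (Gcomp (Gbranch Gid Gnot) Gswap).

(* On 0vb 111 s_0 s_1, the target b is followed by s_0 at distance 4 and by
   s_1 at distance 5. *)
Definition read : gate := gpeel 1 (Gbranch (xor_bit 3) (xor_bit 4)).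

(** Reads v off either recorded form: the middle bit of 0vy, or the complement of the last bit of
    10w. *)
Definition steer (u : seq bool) : bool :=
  if nth false u 0 then ~~ nth false u 2 else nth false u 1.

Lemma NON_hat2 a b c y : [:: a; b; c] <> hat2 -> y = [::] \/ NON hat2 y ->
  NON hat2 ([:: a; b; c] ++ y).
Proof. by move=> na ny; apply/NON_cat. Qed.

(** This is what the scheme asks of [d]. Only the third block can change, by a permutation of
    three-bit blocks fixing 111, so the delimiter neither moves nor appears earlier. *)
Lemma carry_code x : NON hat2 x ->
  exists2 x', NON hat2 x' & act carry (x ++ hat2) = x' ++ hat2.
Proof.
move=> nx; have [//|a [y [-> sa na yP]]] := NON_block _ nx.
case: a sa na => [|a1 [|a2 [|a3 [|a4 a]]]]// _ na.
have id_case z : NON hat2 z -> act carry (z ++ hat2) = z ++ hat2 ->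
    exists2 x', NON hat2 x' & act carry (z ++ hat2) = x' ++ hat2.
  by move=> nz e; exists z.
have := NON_hat2 na yP; case: yP => [-> n0|ny _].
  (* With a single block the word ends with the delimiter, before the place where the gate would
     act. *)
  by apply: id_case => //; rewrite /= !if_same.
have [//|b [y1 [-> sb nb yP]]] := NON_block _ ny.
case: b sb nb => [|b1 [|b2 [|b3 [|b4 b]]]]// _ nb.
case: yP => [->|ny1].
  (* With two blocks the gate hits the delimiter itself, which it fixes. *)
  apply: id_case; last first.
    by rewrite -!catA act_carry//; case: (a3).
  by apply: NON_hat2 => //; right; apply: NON_hat2 => //; left.
have [//|c [y2 [-> sc nc yP]]] := NON_block _ ny1.
case: c sc nc => [|c1 [|c2 [|c3 [|c4 c]]]]// _ nc.
suff [e1 [e2 [e3 [ne e]]]] : exists e1 e2 e3, [:: e1; e2; e3] <> hat2 /\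
    act carry (([:: a1; a2; a3] ++ [:: b1; b2; b3] ++ [:: c1; c2; c3] ++ y2) ++ hat2) =
    ([:: a1; a2; a3] ++ [:: b1; b2; b3] ++ [:: e1; e2; e3] ++ y2) ++ hat2.
  exists ([:: a1; a2; a3] ++ [:: b1; b2; b3] ++ [:: e1; e2; e3] ++ y2) => //.
  apply: NON_hat2 => //; right; apply: NON_hat2 => //; right.
  exact: NON_hat2.
rewrite -!catA act_carry//.
by case: a3 {na} => /=; case: c1 nc; case: c2; case: c3 => nc //=;
  do 3 eexists; split; try reflexivity.
Qed.

(** * The search *)

(** Bisection that cuts [s] just as the recursion does, so that each level of [search] matches one
    step of it. *)
Fixpoint lookup (x s : seq bool) : bool :=
  if x is a :: x' then
    lookup x' (if a then drop (LH (size s)) s else take (LH (size s)) s)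
  else head false s.

Lemma LH_expn j : LH (2 ^ j.+1) = (2 ^ j)%N.
Proof. by rewrite /LH expnS mul2n uphalf_double. Qed.

Lemma size_half (a : bool) j (s : seq bool) : size s = (2 ^ j.+1)%N ->
  size (if a then drop (LH (size s)) s else take (LH (size s)) s) = (2 ^ j)%N.
Proof.
move=> ss; have e : (2 ^ j.+1 = 2 ^ j + 2 ^ j)%N by rewrite expnS mul2n addnn.
rewrite ss LH_expn; case: a; rewrite ?size_drop ?size_take ss e; first by rewrite addnK.
by case: ltnP => //; lia.
Qed.

Lemma size_lex_strings k : size (lex_strings k) = (2 ^ k)%N.
Proof.
by elim: k => //= k IH; rewrite size_cat !size_map IH expnS mul2n addnn.
Qed.

Lemma size_bin k m : (0 < m <= 2 ^ k)%N -> size (bin k m) = k.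
Proof.
case/andP; case: m => // i _; rewrite /bin /=.
elim: k i => [|k IH] i; first by case: i.
rewrite /= nth_cat size_map size_lex_strings expnS mul2n -addnn => li.
case: ltnP => h; first by rewrite (nth_map [::]) ?size_lex_strings//= IH.
have lj : (i - 2 ^ k < 2 ^ k)%N by lia.
by rewrite (nth_map [::]) ?size_lex_strings//= IH.
Qed.

(** In lexicographic order the addresses beginning with 0 fill the first half, so the leading bit
    tells which half of [s] holds the index. *)
Lemma lookup_bin k m s : (0 < m <= 2 ^ k)%N -> size s = (2 ^ k)%N ->
  lookup (bin k m) s = nth false s m.-1.
Proof.
case/andP; case: m => // i _; rewrite /bin /=.
elim: k i s => [|k IH] i s; first by case: i => // _; rewrite nth0.
move=> li ss; have := size_half false ss; have := size_half true ss.
move: li; rewrite /= nth_cat size_map size_lex_strings expnS mul2n -addnn => li s1 s0.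
have lh : LH (size s) = (2 ^ k)%N by rewrite ss LH_expn.
case: ltnP => h.
  by rewrite (nth_map [::]) ?size_lex_strings//= IH// lh nth_take.
have lj : (i - 2 ^ k < 2 ^ k)%N by lia.
by rewrite (nth_map [::]) ?size_lex_strings//= IH// lh nth_drop subnKC.
Qed.

Section Search.
Context {R : realType}.
Implicit Types (u v w x y z s : seq bool).

(** The threshold 2 stops the recursion at two bits of s, where [read] finds both candidates at
    known distances. Every block recurses, and [steer] chooses [HalfSWAP] when the right half is
    wanted. *)
Definition search : qfun R :=
  @cfq_sol R 2 hat2 (den carry) (den read) (den uncarry)
    (fun r : (size hat2).-tuple bool => steer r) (fun=> true).

Lemma den_carry_code x : NON hat2 x -> exists2 x', NON hat2 x' &
  den carry (ket (x ++ hat2)) = ket (x' ++ hat2) :> qvec R.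
Proof.
move=> /carry_code[x' nx' e]; exists x' => //.
by rewrite den_ket ?e//; case: (x).
Qed.

Lemma searchP : is_CFQRec 2 hat2 (den carry) (den read) (den uncarry)
  (fun r : (size hat2).-tuple bool => steer r) (fun=> true) search.
Proof.
apply: is_CFQRec_cfq_sol => //; try exact: Hpres_den.
- by move=> n; exact: linear_on_den.
- exact: den_carry_code.
Qed.

Lemma EQS_search (K : set R[i]) cs : EQS K cs true search.
Proof.
apply: (EQS_CFQRec _ _ _ _ _ _ den_carry_code searchP) => //; exact: EQS_den.
Qed.

(** The code has exactly log |z| blocks; dropping one block while halving [z] preserves this
    balance. *)
Lemma search_step u y y' w z j : size u = 3 -> NON hat2 (u ++ y) ->
  size (u ++ y) = (3 * j.+2)%N -> size z = (2 ^ j.+2)%N ->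
  act carry (u ++ y ++ hat2) = u ++ y' ++ hat2 -> size w = size (y ++ hat2) ->
  let s := if steer u then drop (LH (size z)) z else take (LH (size z)) z in
  search (ket (y' ++ hat2 ++ s)) = ket (w ++ s) ->
  search (ket (u ++ y ++ hat2 ++ z)) = ket (act uncarry (u ++ w) ++ z).
Proof.
move=> su nx sx sz; rewrite 2!catA => e sw s Fs.
have nx' : NON hat2 (u ++ y').
  have [x' nx' e'] := carry_code nx.
  have takeK v : take (size (v ++ hat2) - 3) (v ++ hat2) = v.
    by rewrite size_cat addnK take_size_cat.
  by rewrite -(takeK (u ++ y')) -e e' takeK.
have su' : size u == size hat2 by rewrite su.
have nu v : u ++ v <> [::] by case: (u) su.
have dx : den carry (ket ((u ++ y) ++ hat2)) = ket ((u ++ y') ++ hat2) :> qvec R.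
  by rewrite den_ket ?e// -catA; exact: nu.
(* The code length equals [3 * ilog (size z)], and the bound in [cfq_base] is strict. *)
have nb : ~ cfq_base 2 hat2 (u ++ y) (size z).
  rewrite sz => -[|le|]; first exact: nu.
    by have := @ltn_exp2l 2 1 j.+2 isT; rewrite expn1 ltnNge le.
  by rewrite /ilog up_expnK// sx ltnn.
rewrite catA in Fs; rewrite 2!catA.
have -> := cfq_step_ket (u := Tuple su') searchP nx nx' dx nb isT sw Fs.
by rewrite den_ket ?tens_ket//; exact: nu.
Qed.

(* The four forms that the code takes between two levels of the recursion; the
   address is spread over it, in the order given to [lookup]. *)
Lemma search1 c b s : size s = 2 ->
  search (ket ([:: false; c; b] ++ hat2 ++ s)) =
  ket ([:: false; c; b (+) lookup [:: c] s] ++ hat2 ++ s).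
Proof.
move=> ss; rewrite catA -tens_ket (cfq_baseE searchP _ (@Hsp_ket _ s)); first last.
- by rewrite qlen_ket ss; apply: Or32.
- by right; rewrite -[[:: false; _; _]]cats0; apply: NON_hat2 => //; left.
have {ss} [s0 [s1 ->]] : exists s0 s1 : bool, s = [:: s0; s1].
  by case: s ss => [|s0 [|s1 [|]]]// _; exists s0, s1.
rewrite tens_ket den_ket//; congr ket.
by case: c; case: b; case: s0; case: s1; vm_compute.
Qed.

Lemma search2 c1 c2 b s : size s = 4 ->
  search (ket ([:: true; false; ~~ c1] ++ [:: false; c2; b] ++ hat2 ++ s)) =
  ket ([:: true; false; ~~ c1] ++
       [:: false; c2; b (+) lookup [:: c1; c2] s] ++ hat2 ++ s).
Proof.
move=> ss; rewrite (@search_step _ _ [:: false; c2; b]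
  ([:: false; c2; b (+) lookup [:: c1; c2] s] ++ hat2) _ 0)//.
- by rewrite act_uncarry// -!catA; case: (c1).
- by apply: NON_hat2 => //; right; rewrite -[[:: false; _; _]]cats0; apply: NON_hat2 => //; left.
- by rewrite act_carry//; case: (c1).
- have -> : steer [:: true; false; ~~ c1] = c1 by exact: negbK.
  by rewrite search1// (@size_half _ 1).
Qed.

Lemma search3 m2 c1 c2 b s : size s = 8 ->
  search (ket ([:: false; m2; c2] ++ [:: true; false; ~~ c1] ++
               hat b ++ hat2 ++ s)) =
  ket ([:: false; m2; c2] ++ [:: true; false; ~~ c1] ++
       hat (b (+) lookup [:: m2; c1; c2] s) ++ hat2 ++ s).
Proof.
move=> ss; rewrite (catA _ (hat b)) (@search_step _ _
  ([:: true; false; ~~ c1] ++ [:: false; c2; b])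
  ([:: true; false; ~~ c1] ++
       [:: false; c2; b (+) lookup [:: m2; c1; c2] s] ++ hat2) _ 1)//.
- by rewrite act_uncarry// -!catA; case: (c2).
- do 2 (apply: NON_hat2 => //; right).
  by rewrite -[hat b]cats0; apply: NON_hat2 => //; left.
- by rewrite -!catA act_carry//; case: (c2).
- by rewrite -!catA search2// (@size_half _ 2).
Qed.

Lemma NON_hats ys b : NON hat2 (flatten (map hat ys) ++ hatend ++ hat b).
Proof.
elim: ys => [|y ys IH]; last by apply: (@NON_hat2 false false y) => //; right.
apply: NON_hat2 => //; right.
by rewrite -[hat b]cats0; apply: NON_hat2 => //; left.
Qed.

Lemma search4 m1 m2 c1 c2 ys b s : size s = (2 ^ (size ys).+4)%N ->
  search (ket ([:: false; m1; c1] ++ [:: false; m2; c2] ++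
    flatten (map hat ys) ++ hatend ++ hat b ++ hat2 ++ s)) =
  ket ([:: false; m1; c1] ++ [:: false; m2; c2] ++ flatten (map hat ys) ++ hatend
    ++ hat (b (+) lookup (m1 :: m2 :: c1 :: c2 :: ys) s) ++ hat2 ++ s).
Proof.
have size_hats zs : size (flatten (map hat zs)) = (3 * size zs)%N.
  by elim: zs => //= z zs ->; rewrite mulnS.
elim: ys m1 m2 c1 c2 s => [|y ys IH] m1 m2 c1 c2 s ss.
  (* With no address bits left behind, the block hit by [carry] is the marker, which takes the form
     10w. *)
  have E (v : bool) (t : seq bool) : [:: false; m1; c1] ++ [:: false; m2; c2] ++
      flatten (map hat [::]) ++ hatend ++ hat v ++ hat2 ++ t =
      [:: false; m1; c1] ++ ([:: false; m2; c2] ++ hatend ++ hat v) ++ hat2 ++ t.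
    by [].
  rewrite !E (@search_step _ _
    ([:: false; m2; c2] ++ [:: true; false; ~~ c1] ++ hat b)
    ([:: false; m2; c2] ++ [:: true; false; ~~ c1] ++
     hat (b (+) lookup (m1 :: m2 :: c1 :: c2 :: [::]) s) ++ hat2) _ 2)//.
  - by rewrite act_uncarry// -!catA; case: (c1).
  - do 2 (apply: NON_hat2 => //; right); exact: (@NON_hats [::]).
  - by rewrite -!catA act_carry//; case: (c1).
  - by rewrite -!catA search3// (@size_half _ 3).
set b' := b (+) _.
pose rest (v : bool) := flatten (map hat ys) ++ hatend ++ hat v.
have -> (v : bool) (t : seq bool) : [:: false; m1; c1] ++ [:: false; m2; c2] ++
    flatten (map hat (y :: ys)) ++ hatend ++ hat v ++ hat2 ++ t =
    [:: false; m1; c1] ++ ([:: false; m2; c2] ++ hat y ++ rest v) ++ hat2 ++ t.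
  by rewrite /rest /= -!catA.
rewrite (@search_step _ _
    ([:: false; m2; c2] ++ [:: false; c1; y] ++ rest b)
    ([:: false; m2; c2] ++ [:: false; c1; y] ++ rest b' ++ hat2) _ (size ys).+3)//.
(* On the way back [uncarry] clears the bit [c1] recorded in the block of [y]. *)
- have undo z : act (if c1 then Gcomp Gswap flag else Gswap)
      ([:: false; c1; y] ++ z) = hat y ++ z by case: (c1).
  by rewrite act_uncarry// undo /rest -!catA.
- rewrite /rest; do 2 (apply: NON_hat2 => //; right).
  exact: (@NON_hats (y :: ys)).
- by rewrite /rest !size_cat size_hats /=; lia.
- by rewrite /rest -!catA act_carry//; case: (c1).
- by rewrite /rest !size_cat.
- by rewrite /rest -!catA IH// (@size_half _ (size ys).+4).
Qed.

End Search.

(** * Entering and leaving the recursion *)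

Definition pre : gate := Gcomp (gpeel 3 carry) carry.
Definition post : gate := Gcomp uncarry (gpeel 3 uncarry).

Lemma act_comp c1 c2 w : act (Gcomp c1 c2) w = act c1 (act c2 w).
Proof. by []. Qed.

Lemma act_pre a1 b1 v1 a2 b2 v2 w w' z :
  w <> [::] -> size w' = 3 -> z <> [::] ->
  act (if v1 then Gcomp flag Gswap else Gswap) (w ++ z) = w' ++ z ->
  act pre ([:: a1; b1; v1] ++ [:: a2; b2; v2] ++ w ++ z) =
  [:: a1; b1; v1] ++ [:: a2; b2; v2] ++ w' ++
    act (if v2 then Gcomp flag Gswap else Gswap) z.
Proof.
move=> nw sw' nz e.
rewrite /pre act_comp act_carry//; last by case: (w) nw.
by rewrite e act_gpeel// act_carry.
Qed.

Section BinSearch.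
Context {R : realType}.

Definition bin_search : qfun R := den post \o peel 6 search \o den pre.

(** Indices 1 and 2 mark the words before and after [search]; primes mark those between [pre] and
    [post]. The split isolates the third block, changed by [v1], from the rest, changed by [v2]. *)
Lemma bin_searchE a1 b1 v1 a2 b2 v2 w1 w1' z1 z1' w2 w2' z2 z2' :
  w1 <> [::] -> size w1' = 3 -> z1 <> [::] -> z1' <> [::] ->
  size w2' = 3 -> z2 <> [::] -> z2' <> [::] ->
  act (if v1 then Gcomp flag Gswap else Gswap) (w1 ++ z1) = w1' ++ z1 ->
  act (if v2 then Gcomp flag Gswap else Gswap) z1 = z1' ->
  search (ket (w1' ++ z1')) = ket (w2' ++ z2') :> qvec R ->
  act (if v2 then Gcomp Gswap flag else Gswap) z2' = z2 ->
  act (if v1 then Gcomp Gswap flag else Gswap) (w2' ++ z2) = w2 ++ z2 ->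
  bin_search (ket ([:: a1; b1; v1] ++ [:: a2; b2; v2] ++ w1 ++ z1)) =
  ket ([:: a1; b1; v1] ++ [:: a2; b2; v2] ++ w2 ++ z2).
Proof.
move=> nw1 sw1 nz1 nz1' sw2 nz2 nz2' e1 e1' Hs e2' e2.
have F0 : search (0 : qvec R) = 0.
  exact: Hpres0 (EQS_Hpres (@EQS_search R set0 true)).
rewrite /bin_search /comp den_ket// (act_pre _ _ _ _ _ nw1 sw1 nz1 e1) e1' 2!catA -catA.
rewrite (peel_ket _ _ F0 Hs)//; last by case: (w1') sw1.
rewrite den_ket// -catA.
rewrite /post act_comp act_gpeel//.
rewrite act_uncarry// e2' act_uncarry ?e2//.
by case: (w2') sw2.
Qed.

Lemma bin_searchP x b s : x <> [::] -> size s = (2 ^ size x)%N ->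
  bin_search (ket (flatten (map hat x) ++ hatend ++ hat b ++ hat2 ++ s)) =
  ket (flatten (map hat x) ++ hatend ++ hat (b (+) lookup x s) ++ hat2 ++ s).
Proof.
case: x => [|x1 [|x2 [|x3 [|x4 ys]]]]// _ ss.
(* One address bit: the marker is the second block, and its last bit 1 steers the second carry onto
   111, which stays fixed. *)
- set b' := _ (+) _.
  apply: (@bin_searchE false false x1 false true true (hat b)
    [:: false; x1; b] (hat2 ++ s) (hat2 ++ s)
    (hat b') [:: false; x1; b'] (hat2 ++ s) (hat2 ++ s)) => //.
  + by case: (x1).
  + exact: search1.
  + by case: (x1).
(* Two bits: the marker records [x1] and the block of [b] records [x2]. *)
- set b' := _ (+) _.
  apply: (@bin_searchE false false x1 false false x2 hatend
    [:: true; false; ~~ x1] (hat b ++ hat2 ++ s) ([:: false; x2; b] ++ hat2 ++ s)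
    hatend [:: true; false; ~~ x1]
    (hat b' ++ hat2 ++ s) ([:: false; x2; b'] ++ hat2 ++ s)) => //.
  + by case: (x1).
  + by case: (x2).
  + exact: search2.
  + by case: (x2).
  + by case: (x1).
(* Three bits: the block of [x3] records [x1] and the marker records [x2]. *)
- set b' := _ (+) _.
  apply: (@bin_searchE false false x1 false false x2 (hat x3)
    [:: false; x1; x3] (hatend ++ hat b ++ hat2 ++ s)
    ([:: true; false; ~~ x2] ++ hat b ++ hat2 ++ s)
    (hat x3) [:: false; x1; x3] (hatend ++ hat b' ++ hat2 ++ s)
    ([:: true; false; ~~ x2] ++ hat b' ++ hat2 ++ s)) => //.
  + by case: (x1).
  + by case: (x2).
  + exact: search3.
  + by case: (x2).
  + by case: (x1).
(* From four bits on, the blocks of [x3] and [x4] record [x1] and [x2], and the marker is still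
   untouched. *)
- set b' := _ (+) _.
  pose rest (v : bool) := flatten (map hat ys) ++ hatend ++ hat v ++ hat2 ++ s.
  have E v : flatten (map hat [:: x1, x2, x3, x4 & ys]) ++ hatend ++ hat v ++
      hat2 ++ s = hat x1 ++ hat x2 ++ hat x3 ++ hat x4 ++ rest v.
    by rewrite /rest -!catA.
  rewrite !E; apply: (@bin_searchE false false x1 false false x2 (hat x3)
    [:: false; x1; x3] (hat x4 ++ rest b) ([:: false; x2; x4] ++ rest b)
    (hat x3) [:: false; x1; x3] (hat x4 ++ rest b')
    ([:: false; x2; x4] ++ rest b')) => //.
  + by case: (x1).
  + by case: (x2).
  + exact: search4.
  + by case: (x2).
  + by case: (x1).
Qed.

End BinSearch.

Theorem theorem4p7 (R : realType) (K : set R[i]) :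
  exists BinSearch : qfun R, EQS0_IV K BinSearch /\
    forall (k m : nat) (x : seq bool) (s : (2 ^ k).-tuple bool) (b : bool),
      (1 <= k)%N -> (1 <= m <= 2 ^ k)%N -> x = bin k m ->
      BinSearch (ket (tilde x) ⊗ ket (hat b) ⊗ ket hat2 ⊗ ket s) =
      ket (tilde x) ⊗ ket (hat (b (+) nth false s m.-1)) ⊗ ket hat2 ⊗ ket s.
Proof.
exists bin_search; split.
  apply: EQS_Compo; last exact: EQS_den.
  by apply: EQS_Compo; [exact: EQS_den|exact/EQS_peel/EQS_search].
move=> k m x s b k0 mk ->.
rewrite !tens_ket /tilde -!catA bin_searchP.
- by rewrite lookup_bin// size_tuple.
- by move=> e; have := size_bin mk; rewrite e => k1; rewrite -k1 in k0.
- by rewrite size_bin// size_tuple.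
Qed.
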